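(* For every real number $k>1$ there exists $\varepsilon\in(0,\tfrac12)$ with $k(1-2\varepsilon)^2>1$ (so that partial recovery in the broadcast tree model with these parameters is possible), and yet there is a monotone cutting adversary for which partial recovery in the cutting semirandom broadcast tree model is information-theoretically impossible: no estimator of the root spin, as a function of the observed tree and the spins of its leaves, achieves partial recovery.
   Context: Broadcast tree model with parameters $k>0$, $\varepsilon\in[0,\frac12)$ and depth $R$ (equivalently $a=2k(1-\varepsilon)$, $b=2k\varepsilon$): the root $\rho$ (level 0) gets a uniformly random spin $\sigma_\rho\in\{\pm1\}$; each node gives birth independently to $\mathrm{Pois}(a/2)$ children of its own spin and $\mathrm{Pois}(b/2)$ children of the opposite spin, until level $R$; nodes at level $R$ are the leaves. Cutting semirandom model: sample such a precursor tree; an adversary (seeing the whole labeled tree) may delete any edges joining a node to a child of opposite spin, thereby removing the corresponding subtrees; the resulting tree (topology) together with the spins of its remaining leaves is observed, the removed subtrees are not revealed. An estimator $\hat\sigma_\rho$ achieves partial recovery if there exists $\eta>\frac12$ such that $\Pr[\hat\sigma_\rho=\sigma_\rho]\ge\eta$ as $R\to\infty$. (It is known that partial recovery in the random broadcast tree model is possible when $k(1-2\varepsilon)^2>1$.) *)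

(* Defs.v *)
From HB Require Import structures.
From mathcomp Require Import all_boot all_order all_algebra.
From mathcomp Require Import all_classical all_reals all_analysis.

Set Implicit Arguments.
Unset Strict Implicit.
Unset Printing Implicit Defensive.
Import Order.TTheory GRing.Theory Num.Theory.
Local Open Scope classical_set_scope.
Local Open Scope ring_scope.

Inductive tree (L : Type) : Type := Node of L & seq (tree L).

Section TreeChoice.
Variable L : Type.

Fixpoint tree_encode (t : tree L) : GenTree.tree L :=
  let: Node x cs := t in
  GenTree.Node 0 (GenTree.Leaf x :: map tree_encode cs).

Fixpoint tree_decode (g : GenTree.tree L) : option (tree L) :=
  if g is GenTree.Node _ (GenTree.Leaf x :: gs)
  then Some (Node x (pmap tree_decode gs)) else None.

Fixpoint tree_encodeK (t : tree L) : tree_decode (tree_encode t) = Some t.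
Proof.
case: t => x cs /=; congr (Some (Node x _)).
by elim: cs => //= c cs IHcs; rewrite tree_encodeK /= IHcs.
Qed.

End TreeChoice.

HB.instance Definition _ (L : eqType) :=
  Equality.copy (tree L) (pcan_type (@tree_encodeK L)).
HB.instance Definition _ (L : choiceType) :=
  Choice.copy (tree L) (pcan_type (@tree_encodeK L)).

Definition root_label (L : Type) (t : tree L) : L := let: Node x _ := t in x.

(* Isomorphism of rooted labelled trees, children being unordered. *)
Inductive tree_iso (L : Type) : tree L -> tree L -> Prop :=
| TreeIso x cs cs' : forest_iso cs cs' -> tree_iso (Node x cs) (Node x cs')
with forest_iso (L : Type) : seq (tree L) -> seq (tree L) -> Prop :=
| ForestIsoNil : forest_iso [::] [::]
| ForestIsoCons c c' cs cs1 cs2 :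
    tree_iso c c' -> forest_iso cs (cs1 ++ cs2) ->
    forest_iso (c :: cs) (cs1 ++ c' :: cs2).

(* Spins are booleans: true is +1, false is -1. *)

Section BroadcastTree.
Variable R : realType.

(* Probability mass function of the depth-d broadcast tree given the root spin
   s.  A node's own-spin children are listed before its opposite-spin ones;
   estimators, being invariant under tree_iso, cannot exploit this order. *)
Fixpoint broadcast_pmf (a b : R) (d : nat) (s : bool) (t : tree bool) : R :=
  if d is d'.+1 then
    let: Node x cs := t in
    let own := [seq c <- cs | root_label c == s] in
    let opp := [seq c <- cs | root_label c == ~~ s] in
    if (x == s) && (cs == own ++ opp) then
      (poisson_pmf (a / 2) (size own) *
         \prod_(c <- own) broadcast_pmf a b d' s c) *
      (poisson_pmf (b / 2) (size opp) *
         \prod_(c <- opp) broadcast_pmf a b d' (~~ s) c)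
    else 0
  else (t == Node s [::])%:R.

Definition broadcast_prob (a b : R) (d : nat) (A : set (tree bool)) : \bar R :=
  \esum_(t in A) (2^-1 * broadcast_pmf a b d (root_label t) t)%:E.

End BroadcastTree.

(* cut_tree t t': t' is obtained from t by deleting some edges between a node
   and a child of opposite spin, with the subtrees hanging from them. *)
Inductive cut_tree : tree bool -> tree bool -> Prop :=
| CutTree s cs cs' : cut_children s cs cs' -> cut_tree (Node s cs) (Node s cs')
with cut_children : bool -> seq (tree bool) -> seq (tree bool) -> Prop :=
| CutNil s : cut_children s [::] [::]
| CutDelete s c cs cs' :
    root_label c = ~~ s -> cut_children s cs cs' ->
    cut_children s (c :: cs) cs'
| CutKeep s c c' cs cs' :
    cut_tree c c' -> cut_children s cs cs' ->
    cut_children s (c :: cs) (c' :: cs').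

(* The first argument of adversaries and estimators is the depth. *)
Definition cutting_adversary (adv : nat -> tree bool -> tree bool) : Prop :=
  forall d t, cut_tree t (adv d t).

(* Only the nodes at level d, the leaves, keep their spin. *)
Fixpoint observe (d : nat) (t : tree bool) : tree (option bool) :=
  let: Node s cs := t in
  if d is d'.+1 then Node None [seq observe d' c | c <- cs]
  else Node (Some s) [::].

Definition root_estimator (est : nat -> tree (option bool) -> bool) : Prop :=
  forall d o o', tree_iso o o' -> est d o = est d o'.

Definition partial_recovery (R : realType) (a b : R)
    (adv : nat -> tree bool -> tree bool)
    (est : nat -> tree (option bool) -> bool) : Prop :=
  exists2 eta : R, 2^-1 < eta &
    \forall d \near \oo,
      (eta%:E <= broadcast_prob a b d
        [set t | est d (observe d (adv d t)) = root_label t])%E.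

(* Main.v *)
Require Import Defs.
From mathcomp Require Import all_boot all_order all_algebra.
From mathcomp Require Import all_classical all_reals all_analysis.
From mathcomp Require Import ring lra.
Import Order.TTheory GRing.Theory Num.Theory.
Import numFieldNormedType.Exports.
Set Implicit Arguments.
Unset Strict Implicit.
Unset Printing Implicit Defensive.
Local Open Scope classical_set_scope.
Local Open Scope ring_scope.

(** On a path u - v - w whose middle vertex has no other child, deleting the
    configurations where v differs from both u and w weakens the correlation
    between u and w, since these are configurations with w = u.  Deleting all of
    them would overshoot and make the correlation negative for small
    1 - 2 eps, so the deletion is made conditional on an event independent of
    everything observed: the adversary erases every childless child of v of
    spin opposite to v, and cuts v off only if it erased at least one.

    The adversary works on blocks of two levels.  The observed children of a
    vertex form a Poisson process whose intensity depends on its spin, and the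
    squared Hellinger distance of two Poisson processes is at most that of
    their intensities.  An edge contracts the squared Hellinger distance of the
    laws below the two spins by (1 - 2 eps)^2, a thinned path by strictly
    more than (1 - 2 eps)^4.  Hence one block multiplies it by a factor that is
    below 1 at k (1 - 2 eps)^2 = 1 and, by continuity, for slightly smaller
    eps.  The laws of the observation under the two root spins thus merge as
    the depth grows. *)

Section ExtendedSums.
Context {R : realType}.
Local Open Scope ereal_scope.

Lemma esum_supp (T : choiceType) (A : set T) (f : T -> \bar R) :
  (forall x, ~ A x -> f x = 0) ->
  \esum_(x in [set: T]) f x = \esum_(x in A) f x.
Proof.
move=> fA; rewrite [RHS]esum_mkcond; apply: eq_esum => x _.
by case: ifPn => //; rewrite notin_setE => /fA.
Qed.

Lemma esum_supp1 (T : choiceType) (t : T) (f : T -> \bar R) : 0 <= f t ->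
  (forall x, x != t -> f x = 0) -> \esum_(x in [set: T]) f x = f t.
Proof.
by move=> ft0 f0; rewrite (@esum_supp _ [set t]) ?esum_set1// => x /eqP/f0.
Qed.

Lemma esumD1 (T : choiceType) (t : T) (f : T -> \bar R) :
  (forall x, 0 <= f x) ->
  \esum_(x in [set: T]) f x = f t + \esum_(x in ~` [set t]) f x.
Proof. by move=> f0; rewrite (esumID [set t])// !setTI esum_set1. Qed.

Lemma ge0_esumZl (T : choiceType) (c : \bar R) (f : T -> \bar R) (D : set T) :
  0 <= c -> (forall x, 0 <= f x) ->
  \esum_(x in D) (c * f x) = c * \esum_(x in D) f x.
Proof.
move=> + f0; case: c => [c c0|_|//].
- rewrite /esum -ereal_supZl//; last first.
    by apply/set0P; exists 0, set0; [exact: fsets_set0|rewrite fsbig_set0].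
  congr ereal_sup; apply/seteqP; split => [_ [X DX <-]|_ [_ [X DX <-] <-]] /=.
    by exists (\sum_(x \in X) f x); [exists X|rewrite ge0_mule_fsumr].
  by exists X => //; rewrite ge0_mule_fsumr.
- have [f_eq0|] := pselect (forall x, D x -> f x = 0).
    by rewrite !esum1 ?mule0// => x /f_eq0 ->; rewrite mule0.
  move/existsNP => [x /not_implyP[Dx /eqP fx]].
  have fx_gt0 : 0 < f x by rewrite lt_def fx f0.
  have le_esum1 (h : T -> \bar R) :
      (forall y, 0 <= h y) -> h x <= \esum_(y in D) h y.
    move=> h0; rewrite (esumID [set x])// setI1 mem_set// esum_set1//.
    by rewrite leeDl// esum_ge0.
  rewrite [RHS]gt0_mulye; last exact: lt_le_trans fx_gt0 (le_esum1 _ f0).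
  apply/eqP; rewrite -leye_eq (le_trans _ (le_esum1 _ _)) ?gt0_mulye// => y.
  by rewrite mule_ge0.
Qed.

Lemma esum_pair (S T : choiceType) (f : S -> T -> \bar R) :
  (forall x y, 0 <= f x y) ->
  \esum_(x in [set: S]) \esum_(y in [set: T]) f x y =
  \esum_(p in [set: S * T]) f p.1 p.2.
Proof. by move=> f0; rewrite esum_esum//; congr esum; apply/seteqP. Qed.

Lemma exchange_esum (S T : choiceType) (f : S -> T -> \bar R) :
  (forall x y, 0 <= f x y) ->
  \esum_(x in [set: S]) \esum_(y in [set: T]) f x y =
  \esum_(y in [set: T]) \esum_(x in [set: S]) f x y.
Proof.
move=> f0; rewrite !esum_pair//.
rewrite (reindex_esum [set: T * S] [set: S * T] (fun p => (p.2, p.1)))//.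
by split=> // [[y x] [y' x'] _ _ /= [-> ->]|[x y] _]; [|exists (y, x)].
Qed.

Lemma esum_Node (L : choiceType) (x : L) (f : tree L -> \bar R) :
  (forall t, root_label t != x -> f t = 0) ->
  \esum_(t in [set: tree L]) f t =
  \esum_(cs in [set: seq (tree L)]) f (Node x cs).
Proof.
move=> f0; rewrite (@esum_supp _ [set t | root_label t = x])//; last first.
  by move=> t /eqP /f0.
apply: reindex_esum; split => [cs _ //|cs cs' _ _ /= [//]|[y cs] /= ->].
by exists cs.
Qed.

Lemma esum_size (T : choiceType) (f : seq T -> \bar R) : (forall l, 0 <= f l) ->
  \esum_(l in [set: seq T]) f l =
  \esum_(n in [set: nat]) \esum_(l in [set l | size l = n]) f l.
Proof.
move=> f0; rewrite -esum_bigcupT//.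
  by congr esum; apply/seteqP; split => // l _; exists (size l).
by move=> i j _ _ [l [/= <- <-]].
Qed.

Lemma esum_sizeS (T : choiceType) n (f : seq T -> \bar R) :
  (forall l, 0 <= f l) ->
  \esum_(l in [set l | size l = n.+1]) f l =
  \esum_(x in [set: T]) \esum_(l in [set l | size l = n]) f (x :: l).
Proof.
move=> f0; rewrite esum_esum//.
apply: (reindex_esum ([set: T] `*`` (fun=> [set l | size l = n])) _
  (fun p => p.1 :: p.2)).
split=> [[x l] [_ /= ->] //|[x l] [y k] _ _ /= [-> ->] //|[//|x l] /= [nl]].
by exists (x, l).
Qed.

Lemma esum_singletons (T : choiceType) (f : seq T -> \bar R) :
  (forall l, 0 <= f l) ->
  \esum_(l in [set: seq T]) f l =
  \esum_(l in [set: seq T]) (if size l == 1%N then 0 else f l) +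
  \esum_(x in [set: T]) f [:: x].
Proof.
move=> f0; rewrite (esumID [set l | size l = 1%N])// !setTI addeC.
congr (_ + _).
  rewrite [in RHS](@esum_supp _ (~` [set l | size l = 1%N])).
    by apply: eq_esum => l /= /eqP/negbTE ->.
  by move=> l /contrapT /= ->.
rewrite esum_sizeS//; apply: eq_esum => x _.
rewrite (_ : [set l | _] = [set [::]]) ?esum_set1//.
by apply/seteqP; split => l /=; [move/size0nil|move=> ->].
Qed.

(* A list whose elements satisfying [p] come first is the concatenation of a
   unique pair in the support of [f]. *)
Lemma esum_cat_filter (T : choiceType) (p : pred T)
    (f : seq T -> seq T -> \bar R) :
  (forall l k, 0 <= f l k) ->
  (forall l k, ~~ (all p l && all (predC p) k) -> f l k = 0) ->
  \esum_(l in [set: seq T]) \esum_(k in [set: seq T]) f l k =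
  \esum_(cs in [set cs | cs = [seq x <- cs | p x] ++ [seq x <- cs | ~~ p x]])
    f [seq x <- cs | p x] [seq x <- cs | ~~ p x].
Proof.
move=> f0 fsupp; rewrite esum_pair//.
pose A := [set lk : seq T * seq T | all p lk.1 && all (predC p) lk.2].
rewrite (@esum_supp _ A) => [|[l k] /negP /fsupp //].
have filter_none (q : pred T) l : all (predC q) l -> [seq x <- l | q x] = [::].
  by rewrite all_predC has_filter negbK => /eqP.
have cat_filter l k : A (l, k) ->
    ([seq x <- l ++ k | p x], [seq x <- l ++ k | ~~ p x]) = (l, k).
  move=> /andP[/= lp kp]; rewrite !filter_cat (all_filterP lp) (all_filterP kp).
  rewrite (filter_none p)// cats0 filter_none//.
  by apply: sub_all lp => x /=; rewrite negbK.
rewrite [RHS](reindex_esum A _ (fun lk => lk.1 ++ lk.2)).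
  by apply: eq_esum => -[l k] /cat_filter [/= -> ->].
split=> [[l k] /cat_filter [/= -> ->]//| |cs csE].
- move=> [l k] [l' k'] /set_mem lkA /set_mem lkA' /= eq_cat.
  by rewrite -(cat_filter _ _ lkA) eq_cat (cat_filter _ _ lkA').
- exists ([seq x <- cs | p x], [seq x <- cs | ~~ p x]); last exact: esym.
  by rewrite /A/= !filter_all.
Qed.

End ExtendedSums.

Section WeightedSums.
Context {R : realType}.
Local Open Scope ereal_scope.

Definition wsum (T : choiceType) (w : T -> R) (F : T -> \bar R) : \bar R :=
  \esum_(x in [set: T]) ((w x)%:E * F x).

Definition has_mass (T : choiceType) (w : T -> R) (m : R) : Prop :=
  (forall x, (0 <= w x)%R) /\ \esum_(x in [set: T]) (w x)%:E = m%:E.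

Definition weight_on (T : choiceType) (p : pred T) (w : T -> R) (x : T) : R :=
  (if p x then w x else 0)%R.

Definition pushforward (X Y : choiceType) (h : X -> Y) (w : X -> R) : Y -> R :=
  fun y => fine (\esum_(x in h @^-1` [set y]) (w x)%:E).

Lemma adde_EFin_eq (x : \bar R) (p q : R) : p%:E + x = q%:E -> x = (q - p)%:E.
Proof. by case: x => [x| |] //= [<-]; rewrite addrAC subrr add0r. Qed.

Lemma mule_onemD (q : R) (x : \bar R) : (0 <= q <= 1)%R -> 0 <= x ->
  q%:E * x + (1 - q)%:E * x = x.
Proof.
move=> /andP[q0 q1] x0.
by rewrite -ge0_muleDl ?lee_fin ?subr_ge0// -EFinD subrKC mul1e.
Qed.

Section WeightedSumTheory.
Variables (T : choiceType) (w : T -> R).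
Hypothesis w0 : forall x, (0 <= w x)%R.
Implicit Types F G : T -> \bar R.

Let ge0_term F : (forall x, 0 <= F x) -> forall x, 0 <= (w x)%:E * F x.
Proof. by move=> F0 x; rewrite mule_ge0// lee_fin. Qed.

Lemma wsum_ge0 F : (forall x, 0 <= F x) -> 0 <= wsum w F.
Proof. by move=> F0; apply: esum_ge0 => x _; exact: ge0_term. Qed.

Lemma eq_wsum F G : F =1 G -> wsum w F = wsum w G.
Proof. by move=> FG; apply: eq_esum => x _; rewrite FG. Qed.

Lemma wsum1 : wsum w (fun=> 1) = \esum_(x in [set: T]) (w x)%:E.
Proof. by apply: eq_esum => x _; rewrite mule1. Qed.

Lemma wsumD F G : (forall x, 0 <= F x) -> (forall x, 0 <= G x) ->
  wsum w (fun x => F x + G x) = wsum w F + wsum w G.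
Proof.
move=> F0 G0; rewrite /wsum -esumD; last 2 first.
- by move=> x _; exact: ge0_term.
- by move=> x _; exact: ge0_term.
by apply: eq_esum => x _; rewrite ge0_muleDr.
Qed.

Lemma wsumZ c F : 0 <= c -> (forall x, 0 <= F x) ->
  wsum w (fun x => c * F x) = c * wsum w F.
Proof.
move=> c0 F0; rewrite /wsum -ge0_esumZl//; last exact: ge0_term.
by apply: eq_esum => x _; rewrite muleCA.
Qed.

Lemma wsum_sum n (F : nat -> T -> \bar R) : (forall i x, 0 <= F i x) ->
  wsum w (fun x => \sum_(i < n) F i x) = \sum_(i < n) wsum w (F i).
Proof.
move=> F0; rewrite /wsum -esum_sum; last by move=> x i _ _; exact: ge0_term.
by apply: eq_esum => x _; rewrite ge0_sume_distrr.
Qed.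

Lemma weight_on_ge0 (p : pred T) x : (0 <= weight_on p w x)%R.
Proof. by rewrite /weight_on; case: ifP. Qed.

Lemma wsum_weight_on (p : pred T) F :
  wsum (weight_on p w) F = wsum w (fun x => if p x then F x else 0).
Proof.
by apply: eq_esum => x _; rewrite /weight_on; case: ifP; rewrite ?mul0e ?mule0.
Qed.

Lemma wsumID (p : pred T) F : (forall x, 0 <= F x) ->
  wsum w F = wsum (weight_on p w) F + wsum (weight_on (predC p) w) F.
Proof.
move=> F0; rewrite !wsum_weight_on -wsumD; last 2 first.
- by move=> x; case: ifP.
- by move=> x; case: ifP.
by apply: eq_wsum => x /=; case: (p x); rewrite ?adde0 ?add0e.
Qed.

Lemma wsumDw v F : (forall x, (0 <= v x)%R) -> (forall x, 0 <= F x) ->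
  wsum (fun x => v x + w x)%R F = wsum v F + wsum w F.
Proof.
move=> v0 F0; rewrite /wsum -esumD; last 2 first.
- by move=> x _; rewrite mule_ge0// lee_fin.
- by move=> x _; exact: ge0_term.
by apply: eq_esum => x _; rewrite EFinD ge0_muleDl// lee_fin.
Qed.

Lemma wsumZw c F : (0 <= c)%R -> (forall x, 0 <= F x) ->
  wsum (fun x => c * w x)%R F = c%:E * wsum w F.
Proof.
move=> c0 F0; rewrite /wsum -ge0_esumZl ?lee_fin//; last exact: ge0_term.
by apply: eq_esum => x _; rewrite EFinM muleA.
Qed.

Lemma exchange_wsum (S : choiceType) (v : S -> R) (F : T -> S -> \bar R) :
  (forall y, (0 <= v y)%R) -> (forall x y, 0 <= F x y) ->
  wsum w (fun x => wsum v (F x)) = wsum v (fun y => wsum w (F ^~ y)).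
Proof.
move=> v0 F0.
have vF0 x y : 0 <= (v y)%:E * F x y by rewrite mule_ge0// lee_fin.
have wF0 y x : 0 <= (w x)%:E * F x y by rewrite mule_ge0// lee_fin.
rewrite /wsum; under eq_esum do rewrite -ge0_esumZl ?lee_fin//.
under [RHS]eq_esum do rewrite -ge0_esumZl ?lee_fin//.
rewrite exchange_esum; last by move=> x y; rewrite mule_ge0// lee_fin.
by apply: eq_esum => y _; apply: eq_esum => x _; rewrite muleCA.
Qed.

End WeightedSumTheory.

Section Mass.
Variables (T : choiceType) (w : T -> R) (m : R).
Hypothesis wm : has_mass w m.

Lemma mass_ge0 : (0 <= m)%R.
Proof. by rewrite -lee_fin -wm.2 esum_ge0// => x _; rewrite lee_fin wm.1. Qed.

Lemma wsum_cst c : 0 <= c -> wsum w (fun=> c) = c * m%:E.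
Proof.
move=> c0; rewrite -wm.2 -wsum1 -wsumZ ?wm.1//; last exact: wm.1.
by under [RHS]eq_wsum do rewrite mule1.
Qed.

Lemma has_massZ c : (0 <= c)%R -> has_mass (fun x => c * w x)%R (c * m).
Proof.
move=> c0; have w0 := wm.1; split=> [x|]; first exact: mulr_ge0.
by rewrite -wsum1 wsumZw// wsum1 wm.2.
Qed.

Lemma has_massD v p : has_mass v p -> has_mass (fun x => v x + w x)%R (p + m).
Proof.
move=> [v0 vp]; have w0 := wm.1; split=> [x|]; first exact: addr_ge0.
by rewrite -wsum1 wsumDw// !wsum1 vp wm.2.
Qed.

Lemma has_mass_weight_onC (p : pred T) q :
  has_mass (weight_on p w) q -> has_mass (weight_on (predC p) w) (m - q).
Proof.
move=> [_ wq]; have w0 := wm.1; split; first exact: weight_on_ge0.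
by apply: adde_EFin_eq; rewrite -wq -!wsum1 -wsumID// wsum1 wm.2.
Qed.

End Mass.

Lemma esum_preimage (X Y : choiceType) (h : X -> Y) (f : X -> \bar R) :
  (forall x, 0 <= f x) ->
  \esum_(y in [set: Y]) \esum_(x in h @^-1` [set y]) f x =
  \esum_(x in [set: X]) f x.
Proof.
move=> f0; rewrite esum_esum//.
rewrite (reindex_esum [set: X] _ (fun x => (h x, x)))//.
by split=> [x|x x' _ _ [] | [y x] [_ /= <-]] //; exists x.
Qed.

Lemma pushforward_ge0 (X Y : choiceType) (h : X -> Y) (w : X -> R) :
  (forall x, (0 <= w x)%R) -> forall y, (0 <= pushforward h w y)%R.
Proof. by move=> w0 y; apply/fine_ge0/esum_ge0 => x _; rewrite lee_fin. Qed.

Lemma wsum_pushforward (X Y : choiceType) (h : X -> Y) (w : X -> R) m F :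
  has_mass w m -> (forall y, 0 <= F y) ->
  wsum (pushforward h w) F = wsum w (F \o h).
Proof.
move=> [w0 wm] F0; have wE0 x : 0 <= (w x)%:E by rewrite lee_fin.
rewrite /wsum -(esum_preimage h); last by move=> x; rewrite mule_ge0/=.
apply: eq_esum => y _; rewrite fineK.
  by rewrite muleC -ge0_esumZl//; apply: eq_esum => x /= ->; rewrite muleC.
rewrite ge0_fin_numE ?esum_ge0// (@le_lt_trans _ _ m%:E) ?ltry// -wm.
by rewrite esum_mkcond le_esum// => x _; case: ifP.
Qed.

End WeightedSums.

Section BinomialSums.
Context {R : realType}.
Local Open Scope ereal_scope.
Implicit Type K : nat -> nat -> \bar R.

Definition binomial_sum n K : \bar R :=
  \sum_(i < n.+1) ('C(n, i)%:R%:E * K i (n - i)%N).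

Lemma eq_binomial_sum n K K' : (forall i j, K i j = K' i j) ->
  binomial_sum n K = binomial_sum n K'.
Proof. by move=> KK; apply: eq_bigr => i _; rewrite KK. Qed.

Lemma binomial_sum_pascal n K : (forall i j, 0 <= K i j) ->
  binomial_sum n.+1 K =
  binomial_sum n (fun i j => K i.+1 j) + binomial_sum n (fun i j => K i j.+1).
Proof.
move=> K0; rewrite /binomial_sum [LHS]big_ord_recl/= bin0 mul1e subn0.
under [in LHS]eq_bigr => i _ do
  rewrite /= binS natrD EFinD ge0_muleDl ?lee_fin// subSS.
rewrite big_split/= addeA addeC; congr (_ + _).
rewrite big_ord_recr/= bin_small// mul0e adde0.
rewrite [in RHS]big_ord_recl/= bin0 mul1e subn0; congr (_ + _).
by apply: eq_bigr => i _; rewrite subnSK//=.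
Qed.

Lemma binomial_sum_wsum n (T : choiceType) (w : T -> R)
    (K : T -> nat -> nat -> \bar R) :
  (forall x, (0 <= w x)%R) -> (forall x i j, 0 <= K x i j) ->
  wsum w (fun x => binomial_sum n (K x)) =
  binomial_sum n (fun i j => wsum w (fun x => K x i j)).
Proof.
move=> w0 K0; rewrite /binomial_sum.
rewrite (@wsum_sum _ _ _ w0 _ (fun i x => 'C(n, i)%:R%:E * K x i (n - i)%N))//.
  by apply: eq_bigr => i _; rewrite wsumZ.
by move=> i x; rewrite mule_ge0// lee_fin.
Qed.

(* The coefficients of the Poisson distribution of parameter [m], without the
   power of [m]. *)
Definition poisson_coef (m : R) (n : nat) : R := (expR (- m) * n`!%:R^-1)%R.

Lemma poisson_coef_ge0 m n : (0 <= poisson_coef m n)%R.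
Proof. by rewrite mulr_ge0 ?expR_ge0 ?invr_ge0. Qed.

Lemma wsum_binomial_sum m r K : (forall i j, 0 <= K i j) ->
  wsum (poisson_coef (m + r)) (fun n => binomial_sum n K) =
  wsum (poisson_coef m) (fun i => wsum (poisson_coef r) (K i)).
Proof.
move=> K0.
pose f i j := (poisson_coef m i)%:E * ((poisson_coef r j)%:E * K i j).
have f0 i j : 0 <= f i j by rewrite !mule_ge0// lee_fin poisson_coef_ge0.
transitivity (\esum_(n in [set: nat]) \esum_(i in `I_n.+1) f i (n - i)%N).
  apply: eq_esum => n _.
  rewrite ge0_sume_distrr => [|i _]; last by rewrite mule_ge0// lee_fin.
  rewrite esum_fset// -fsbig_ord; apply: eq_bigr => -[i /= lein] _.
  rewrite /f !muleA -!EFinM /poisson_coef opprD expRD; congr (_%:E * _).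
  rewrite -(bin_fact (ltnSE lein)) !natrM.
  have fact_neq0 k : (k`!%:R : R) != 0%R by rewrite pnatr_eq0 -lt0n fact_gt0.
  have bin_neq0 : ('C(n, i)%:R : R) != 0%R by rewrite pnatr_eq0 -lt0n bin_gt0.
  by field; rewrite !fact_neq0 bin_neq0.
transitivity (\esum_(i in [set: nat]) \esum_(j in [set: nat]) f i j);
    last first.
  apply: eq_esum => i _; rewrite ge0_esumZl ?lee_fin ?poisson_coef_ge0// => j.
  by rewrite mule_ge0 ?lee_fin ?poisson_coef_ge0.
rewrite esum_esum// [RHS]esum_pair//.
rewrite (reindex_esum [set: nat * nat] ([set: nat] `*`` (fun n => `I_n.+1))
  (fun p => (p.1 + p.2, p.1)%N)).
  by apply: eq_esum => -[i j] _ /=; rewrite addKn.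
split=> [[i j] _|[i j] [i' j'] _ _ /= [sumE iE]|[n i] [_ /= lein]].
- by split=> //=; rewrite ltnS leq_addr.
- by move: sumE; rewrite iE => /addnI ->.
- by exists (i, n - i)%N => //=; rewrite subnKC.
Qed.

End BinomialSums.

(** * Poisson point processes *)

Section PoissonProcess.
Context {R : realType}.
Local Open Scope ereal_scope.

(* The law of a Poisson point process of intensity [w] and total mass [m], whose
   points are listed in uniformly random order. *)
Definition poisson_law (T : choiceType) (m : R) (w : T -> R) (l : seq T) : R :=
  (poisson_coef m (size l) * \prod_(x <- l) w x)%R.

Fixpoint wsum_iter (T : choiceType) (w : T -> R) n (F : seq T -> \bar R) :
    \bar R :=
  if n is n'.+1 then wsum w (fun x => wsum_iter w n' (fun l => F (x :: l)))
  else F [::].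

Section WsumIter.
Variables (T : choiceType) (w : T -> R).
Hypothesis w0 : forall x, (0 <= w x)%R.
Implicit Types F : seq T -> \bar R.

Lemma wsum_iter_ge0 n F : (forall l, 0 <= F l) -> 0 <= wsum_iter w n F.
Proof. by elim: n F => //= n IHn F F0; apply: wsum_ge0 => // x; exact: IHn. Qed.

Lemma eq_wsum_iter n F F' : F =1 F' -> wsum_iter w n F = wsum_iter w n F'.
Proof. by move=> /funext ->. Qed.

Lemma wsum_iterE n F : (forall l, 0 <= F l) ->
  wsum_iter w n F =
  \esum_(l in [set l | size l = n]) ((\prod_(x <- l) w x)%:E * F l).
Proof.
have prod0 l : 0 <= (\prod_(x <- l) w x)%:E by rewrite lee_fin prodr_ge0.
elim: n F => [|n IHn] F F0.
  rewrite (_ : [set l | _] = [set [::]]).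
    by rewrite esum_set1 big_nil ?mule_ge0// mul1e.
  by apply/seteqP; split => l /=; [move/size0nil|move=> ->].
rewrite esum_sizeS; last by move=> l; rewrite mule_ge0.
apply: eq_esum => x _; rewrite -/wsum_iter IHn// -ge0_esumZl ?lee_fin//.
  by apply: eq_esum => l _; rewrite big_cons EFinM muleA.
by move=> l; rewrite mule_ge0.
Qed.

Lemma wsum_iter1 m n : has_mass w m -> wsum_iter w n (fun=> 1) = (m ^+ n)%:E.
Proof.
move=> wm; have m0 := mass_ge0 wm; elim: n => //= n ->.
by rewrite (wsum_cst wm) ?lee_fin ?exprn_ge0// -EFinM exprSr.
Qed.

Lemma exchange_wsum_iter n (S : choiceType) (v : S -> R)
    (F : seq T -> S -> \bar R) :
  (forall y, (0 <= v y)%R) -> (forall l y, 0 <= F l y) ->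
  wsum_iter w n (fun l => wsum v (F l)) =
  wsum v (fun y => wsum_iter w n (F ^~ y)).
Proof.
move=> v0; elim: n F => //= n IHn F F0; under eq_wsum do rewrite IHn//.
by rewrite exchange_wsum// => x y; exact: wsum_iter_ge0.
Qed.

Lemma poisson_law_ge0 m l : (0 <= poisson_law m w l)%R.
Proof. by rewrite mulr_ge0 ?poisson_coef_ge0// prodr_ge0. Qed.

Lemma wsum_poissonE m F : (forall l, 0 <= F l) ->
  wsum (poisson_law m w) F = wsum (poisson_coef m) (fun n => wsum_iter w n F).
Proof.
move=> F0; rewrite /wsum esum_size => [|l]; last first.
  by rewrite mule_ge0 ?lee_fin ?poisson_law_ge0.
apply: eq_esum => n _; rewrite wsum_iterE// -ge0_esumZl.
- by apply: eq_esum => l /= <-; rewrite /poisson_law EFinM muleA.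
- by rewrite lee_fin poisson_coef_ge0.
- by move=> l; rewrite mule_ge0 ?lee_fin ?prodr_ge0.
Qed.

End WsumIter.

Lemma has_mass_poisson (T : choiceType) (w : T -> R) m :
  has_mass w m -> has_mass (poisson_law m w) 1.
Proof.
move=> wm; have m0 := mass_ge0 wm; have w0 := wm.1.
split; first exact: poisson_law_ge0.
rewrite -wsum1 wsum_poissonE//.
under eq_wsum do rewrite (wsum_iter1 _ wm).
rewrite /wsum; have [m_gt0|m_le0] := ltP 0%R m.
  have : poisson_prob m 0 [set: nat] = 1 := probability_setT _.
  rewrite /poisson_prob m_gt0 => <-; apply: eq_esum => n _.
  by rewrite -EFinM /poisson_coef /poisson_pmf m_gt0; congr EFin; ring.
have -> : m = 0%R by apply/eqP; rewrite eq_le m_le0.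
rewrite (esum_supp1 (t := 0%N)) => [||[//|n] _]; last by rewrite expr0n mule0.
- by rewrite /poisson_coef oppr0 expR0 fact0 invr1 mulr1 mul1e.
- by rewrite expr0 mule1 lee_fin poisson_coef_ge0.
Qed.

Lemma poisson_law_nil (T : choiceType) (w : T -> R) m :
  poisson_law m w [::] = expR (- m).
Proof. by rewrite /poisson_law /poisson_coef big_nil fact0 invr1 !mulr1. Qed.

Lemma poisson_law_seq1 (T : choiceType) (w : T -> R) m x :
  (poisson_law m w [:: x] = expR (- m) * w x)%R.
Proof. by rewrite /poisson_law /poisson_coef big_seq1 invr1 mulr1. Qed.

Lemma poisson_lawZ (T : choiceType) (q : T -> R) r l : (0 < r)%R ->
  (poisson_law r (fun x => r * q x) l =
   poisson_pmf r (size l) * \prod_(x <- l) q x)%R.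
Proof.
move=> r0; rewrite /poisson_law /poisson_coef /poisson_pmf r0.
have -> : (\prod_(x <- l) (r * q x) = r ^+ size l * \prod_(x <- l) q x)%R.
  elim: l => [|x l IHl]; first by rewrite !big_nil mulr1.
  by rewrite !big_cons IHl exprS mulrACA.
ring.
Qed.

Lemma poisson_law_weight_on0 (T : choiceType) (p : pred T) (w : T -> R) m l :
  ~~ all p l -> poisson_law m (weight_on p w) l = 0%R.
Proof.
move=> /allPn[x xl px]; rewrite /poisson_law (big_rem x)//= {1}/weight_on.
by rewrite (negbTE px) mul0r mulr0.
Qed.

Lemma wsum_poisson_nilp (T : choiceType) (w : T -> R) m (x y : \bar R) :
  has_mass w m -> 0 <= x -> 0 <= y ->
  wsum (poisson_law m w) (fun l => if nilp l then x else y) =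
  (expR (- m))%:E * x + (1 - expR (- m))%:E * y.
Proof.
move=> wm x0 y0; have Pm := has_mass_poisson wm; have [P0 _] := Pm.
pose P_nil := weight_on (@nilp T) (poisson_law m w).
have nilm : has_mass P_nil (expR (- m)).
  split; first exact: weight_on_ge0.
  rewrite (esum_supp1 (t := [::])) => [||[]//].
    by rewrite /P_nil /weight_on/= poisson_law_nil.
  by rewrite lee_fin weight_on_ge0.
rewrite (wsumID P0 (@nilp T)) => [|l]; last by case: ifP.
congr (_ + _).
  rewrite muleC -(wsum_cst nilm)// !wsum_weight_on.
  by apply: eq_wsum => l; case: nilp.
rewrite muleC -(wsum_cst (has_mass_weight_onC Pm nilm))// !wsum_weight_on.
by apply: eq_wsum => l /=; case: nilp.
Qed.

Lemma wsum_iter_split (T : choiceType) (p : pred T) (w : T -> R) n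
    (G : seq T -> seq T -> \bar R) :
  (forall x, (0 <= w x)%R) -> (forall l k, 0 <= G l k) ->
  wsum_iter w n (fun l => G [seq x <- l | p x] [seq x <- l | ~~ p x]) =
  binomial_sum n (fun i j => wsum_iter (weight_on p w) i (fun l =>
    wsum_iter (weight_on (predC p) w) j (G l))).
Proof.
move=> w0; elim: n G => [|n IHn] G G0.
  by rewrite /binomial_sum big_ord1 bin0 mul1e.
have wp0 := weight_on_ge0 w0 p; have wpC0 := weight_on_ge0 w0 (predC p).
have iter0 i j (H : seq T -> seq T -> \bar R) : (forall l k, 0 <= H l k) ->
    0 <= wsum_iter (weight_on p w) i (fun l =>
      wsum_iter (weight_on (predC p) w) j (H l)).
  by move=> H0; apply: wsum_iter_ge0 => // l; exact: wsum_iter_ge0.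
rewrite binomial_sum_pascal; last by move=> i j; exact: iter0.
rewrite -[LHS]/(wsum _ _) (wsumID w0 p) => [|x]; last exact: wsum_iter_ge0.
congr (_ + _).
  rewrite -[RHS]binomial_sum_wsum//; last by move=> x i j; exact: iter0.
  rewrite !wsum_weight_on; apply: eq_wsum => x; case: ifP => //= px.
  rewrite -(IHn (fun l => G (x :: l)))//.
  by apply: eq_wsum_iter => l; rewrite px.
transitivity (wsum (weight_on (predC p) w) (fun x => binomial_sum n (fun i j =>
    wsum_iter (weight_on p w) i (fun l => wsum_iter (weight_on (predC p) w) j
      (fun k => G l (x :: k)))))).
  rewrite !wsum_weight_on; apply: eq_wsum => x /=; case: ifP => //= /negbTE px.
  rewrite -(IHn (fun l k => G l (x :: k)))//.
  by apply: eq_wsum_iter => l; rewrite px.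
rewrite binomial_sum_wsum//; last by move=> x i j; exact: iter0.
apply: eq_binomial_sum => i j; rewrite exchange_wsum_iter// => l x.
exact: wsum_iter_ge0.
Qed.

Lemma wsum_poisson_split (T : choiceType) (p : pred T) (w : T -> R) (m r : R)
    (G : seq T -> seq T -> \bar R) :
  (forall x, (0 <= w x)%R) -> (forall l k, 0 <= G l k) ->
  wsum (poisson_law (m + r) w)
    (fun l => G [seq x <- l | p x] [seq x <- l | ~~ p x]) =
  wsum (poisson_law m (weight_on p w)) (fun l =>
    wsum (poisson_law r (weight_on (predC p) w)) (G l)).
Proof.
move=> w0 G0; have wp0 := weight_on_ge0 w0 p.
have wpC0 := weight_on_ge0 w0 (predC p).
rewrite !wsum_poissonE//; last first.
  by move=> l; apply: wsum_ge0 => //; exact: poisson_law_ge0.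
under eq_wsum do rewrite wsum_iter_split//.
rewrite wsum_binomial_sum => [|i j]; last first.
  by apply: wsum_iter_ge0 => // l; exact: wsum_iter_ge0.
apply: eq_wsum => i; under [RHS]eq_wsum_iter do rewrite wsum_poissonE//.
rewrite exchange_wsum_iter// => [j|l j]; first exact: poisson_coef_ge0.
exact: wsum_iter_ge0.
Qed.

Definition list_invariant (Y : eqType) (Z : Type) (e : Y -> Y -> Prop)
    (F : seq Y -> Z) : Prop :=
  (forall l l', perm_eq l l' -> F l = F l') /\
  (forall y y' l, e y y' -> F (y :: l) = F (y' :: l)).

Lemma list_invariant_cons (Y : eqType) (Z : Type) (e : Y -> Y -> Prop)
    (F : seq Y -> Z) y :
  list_invariant e F -> list_invariant e (fun l => F (y :: l)).
Proof.
move=> [permF headF]; split=> [l l' ll'|z z' l zz'].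
  by apply: permF; rewrite perm_cons.
have swap z0 : perm_eq [:: y, z0 & l] [:: z0, y & l].
  by rewrite -[y :: _]/([:: y] ++ [:: z0] ++ l) perm_catCA.
by rewrite (permF _ _ (swap z)) (headF _ z')// -(permF _ _ (swap z')).
Qed.

Section Mapping.
Variables (X Y : choiceType) (v : X -> R) (w : Y -> R) (h : X -> Y).
Variable e : Y -> Y -> Prop.
Hypothesis v0 : forall x, (0 <= v x)%R.
Hypothesis w0 : forall y, (0 <= w y)%R.
Hypothesis wsum_map : forall f : Y -> \bar R, (forall y, 0 <= f y) ->
  {homo f : y y' / e y y' >-> y = y'} -> wsum v (f \o h) = wsum w f.

Lemma wsum_iter_map n (F : seq Y -> \bar R) : (forall l, 0 <= F l) ->
  list_invariant e F -> wsum_iter v n (F \o map h) = wsum_iter w n F.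
Proof.
elim: n F => //= n IHn F F0 F_inv.
rewrite -wsum_map => [|y|y y' yy'] /=.
- apply: eq_wsum => x /=; rewrite -(IHn (fun l => F (h x :: l)))//.
  exact: list_invariant_cons.
- exact: wsum_iter_ge0.
- by apply: eq_wsum_iter => l; exact: F_inv.2.
Qed.

Lemma wsum_poisson_map m (F : seq Y -> \bar R) : (forall l, 0 <= F l) ->
  list_invariant e F ->
  wsum (poisson_law m v) (F \o map h) = wsum (poisson_law m w) F.
Proof.
move=> F0 F_inv; rewrite !wsum_poissonE//; last by move=> l; exact: F0.
by apply: eq_wsum => n; exact: wsum_iter_map.
Qed.

End Mapping.

Section Thinning.
Variables (X Y : choiceType) (v : X -> R) (w : Y -> R).
Variables (p : pred X) (h : X -> Y) (e : Y -> Y -> Prop) (m r : R).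
Hypothesis v0 : forall x, (0 <= v x)%R.
Hypothesis w0 : forall y, (0 <= w y)%R.
Hypothesis wsum_kept : forall f : Y -> \bar R, (forall y, 0 <= f y) ->
  {homo f : y y' / e y y' >-> y = y'} ->
  wsum (weight_on p v) (f \o h) = wsum w f.
Hypothesis mass_deleted : has_mass (weight_on (predC p) v) r.

Lemma wsum_poisson_thin (G : bool -> seq Y -> \bar R) :
  (forall c l, 0 <= G c l) -> (forall c, list_invariant e (G c)) ->
  wsum (poisson_law (m + r) v) (fun l => G (all p l) [seq h x | x <- l & p x]) =
  wsum (poisson_law m w) (fun l =>
    (expR (- r))%:E * G true l + (1 - expR (- r))%:E * G false l).
Proof.
move=> G0 G_inv; have vp0 := weight_on_ge0 v0 p.
have prob_none_ge0 : 0 <= (expR (- r))%:E by rewrite lee_fin expR_ge0.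
have prob_some_ge0 : 0 <= (1 - expR (- r))%:E.
  by rewrite lee_fin subr_ge0 expR_le1 oppr_le0 (mass_ge0 mass_deleted).
rewrite -(wsum_poisson_map vp0 w0 wsum_kept); first last.
- split=> [l l' ll'|y y' l yy'].
    by rewrite ((G_inv true).1 _ _ ll') ((G_inv false).1 _ _ ll').
  by rewrite ((G_inv true).2 _ _ _ yy') ((G_inv false).2 _ _ _ yy').
- by move=> l; rewrite adde_ge0// mule_ge0.
pose H l (k : seq X) := G (nilp k) (map h l).
transitivity (wsum (poisson_law (m + r) v)
    (fun l => H [seq x <- l | p x] [seq x <- l | ~~ p x])).
  apply: eq_wsum => l; congr G.
  by rewrite -[all p l]negbK -has_predC has_filter negbK -size_eq0.
rewrite (@wsum_poisson_split _ _ _ _ _ H)// => [|l k]; last exact: G0.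
apply: eq_wsum => l /=; rewrite -(wsum_poisson_nilp mass_deleted)//.
by apply: eq_wsum => k; rewrite /H; case: nilp.
Qed.

End Thinning.
End PoissonProcess.

(** * The broadcast tree *)

Definition children (L : Type) (t : tree L) : seq (tree L) :=
  let: Node _ cs := t in cs.

Section Broadcast.
Context {R : realType}.
Variables a b : R.
Hypotheses (a0 : 0 < a) (b0 : 0 < b).
Local Open Scope ereal_scope.

Let a20 : (0 < a / 2)%R. Proof. by rewrite divr_gt0. Qed.
Let b20 : (0 < b / 2)%R. Proof. by rewrite divr_gt0. Qed.

Definition offspring_intensity d s (c : tree bool) : R :=
  (a / 2 * broadcast_pmf a b d s c + b / 2 * broadcast_pmf a b d (~~ s) c)%R.

Lemma broadcast_pmf_ge0 d s t : (0 <= broadcast_pmf a b d s t)%R.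
Proof.
elim: d s t => [|d IHd] s [x cs] /=; first exact: ler0n.
by case: ifP => // _; rewrite !mulr_ge0 ?poisson_pmf_ge0// prodr_ge0.
Qed.

Lemma offspring_intensity_ge0 d s c : (0 <= offspring_intensity d s c)%R.
Proof. by rewrite addr_ge0// mulr_ge0 ?broadcast_pmf_ge0// ltW. Qed.

Lemma broadcast_pmf_root d s t :
  root_label t != s -> broadcast_pmf a b d s t = 0%R.
Proof.
case: d t => [|d] [x cs] /= xs; last by rewrite (negbTE xs).
by case: eqP => // -[xE _]; rewrite xE eqxx in xs.
Qed.

Lemma eq_wsum_broadcast d s (F G : tree bool -> \bar R) :
  (forall t, root_label t = s -> F t = G t) ->
  wsum (broadcast_pmf a b d s) F = wsum (broadcast_pmf a b d s) G.
Proof.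
move=> FG; apply: eq_esum => t _.
have [/FG -> //|ts] := eqVneq (root_label t) s.
by rewrite broadcast_pmf_root// !mul0e.
Qed.

Lemma broadcast_probE d (A : set (tree bool)) :
  broadcast_prob a b d A = (2^-1)%:E *
    (wsum (broadcast_pmf a b d true) (fun t => (t \in A)%:R%:E) +
     wsum (broadcast_pmf a b d false) (fun t => (t \in A)%:R%:E)).
Proof.
have term0 s t : 0 <= (broadcast_pmf a b d s t)%:E * (t \in A)%:R%:E.
  by rewrite mule_ge0 ?lee_fin ?broadcast_pmf_ge0.
rewrite /broadcast_prob esum_mkcond /wsum -esumD// -ge0_esumZl ?lee_fin//.
  apply: eq_esum => t _; have pmf_root s := @broadcast_pmf_root d s t.
  case: ifP => _; last by rewrite !mule0 adde0 mule0.
  rewrite !mule1 EFinM; congr (_ * _).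
  case: (root_label t) pmf_root => pmf_root.
    by rewrite (pmf_root false)// adde0.
  by rewrite (pmf_root true)// add0e.
by move=> t; rewrite adde_ge0.
Qed.

Lemma wsum_offspring d s (F : tree bool -> \bar R) : (forall t, 0 <= F t) ->
  wsum (offspring_intensity d s) F =
  (a / 2)%:E * wsum (broadcast_pmf a b d s) F +
  (b / 2)%:E * wsum (broadcast_pmf a b d (~~ s)) F.
Proof.
have pmf0 x c : (0 <= broadcast_pmf a b d x c)%R by exact: broadcast_pmf_ge0.
have [/ltW a2 /ltW b2] := (a20, b20).
by move=> F0; rewrite wsumDw ?wsumZw// => c; rewrite mulr_ge0.
Qed.

Lemma offspring_intensity_own d s :
  weight_on (fun c => root_label c == s) (offspring_intensity d s) =
  (fun c => a / 2 * broadcast_pmf a b d s c)%R.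
Proof.
apply/funext => c; rewrite /weight_on; case: ifPn => [/eqP cs|cs].
  rewrite /offspring_intensity (@broadcast_pmf_root _ (~~ s)) ?mulr0 ?addr0//.
  by rewrite cs; case: s {cs}.
by rewrite broadcast_pmf_root ?mulr0.
Qed.

Lemma offspring_intensity_opposite d s :
  weight_on (predC (fun c => root_label c == s)) (offspring_intensity d s) =
  (fun c => b / 2 * broadcast_pmf a b d (~~ s) c)%R.
Proof.
apply/funext => c; rewrite /weight_on/=; case: ifPn => [cs|/negbNE/eqP cs].
  by rewrite /offspring_intensity (broadcast_pmf_root _ cs) mulr0 add0r.
by rewrite (@broadcast_pmf_root _ (~~ s)) ?mulr0// cs; case: s {cs}.
Qed.

Lemma broadcast_pmf_Node d s cs :
  let own := [seq c <- cs | root_label c == s] in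
  let opp := [seq c <- cs | root_label c != s] in
  broadcast_pmf a b d.+1 s (Node s cs) =
  (if cs == own ++ opp then
    poisson_law (a / 2) (fun c => a / 2 * broadcast_pmf a b d s c) own *
    poisson_law (b / 2) (fun c => b / 2 * broadcast_pmf a b d (~~ s) c) opp
  else 0)%R.
Proof.
rewrite /= eqxx/= !poisson_lawZ//.
have -> // : [seq c <- cs | root_label c == ~~ s] =
    [seq c <- cs | root_label c != s].
by apply: eq_filter => c; case: (root_label c); case: s.
Qed.

Lemma wsum_broadcast d s (F : tree bool -> \bar R) : (forall t, 0 <= F t) ->
  (forall l l', perm_eq l l' -> F (Node s l) = F (Node s l')) ->
  wsum (broadcast_pmf a b d.+1 s) F =
  wsum (poisson_law (a / 2 + b / 2) (offspring_intensity d s)) (F \o Node s).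
Proof.
move=> F0 F_perm; pose p c := root_label c == s.
pose P := poisson_law (a / 2) (weight_on p (offspring_intensity d s)).
pose Q := poisson_law (b / 2) (weight_on (predC p) (offspring_intensity d s)).
have off0 := offspring_intensity_ge0 d s.
have P0 l : (0 <= P l)%R by apply/poisson_law_ge0/weight_on_ge0.
have Q0 l : (0 <= Q l)%R by apply/poisson_law_ge0/weight_on_ge0.
transitivity (wsum P (fun l => wsum Q (fun k => F (Node s (l ++ k)))));
    last first.
  rewrite -(@wsum_poisson_split _ _ _ _ _ _ (fun l k => F (Node s (l ++ k))))//.
  by apply: eq_wsum => l; apply: F_perm; rewrite perm_filterC.
transitivity (\esum_(l in [set: seq (tree bool)])
    \esum_(k in [set: seq (tree bool)]) (P l * Q k)%:E * F (Node s (l ++ k)));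
    last first.
  apply: eq_esum => l _; rewrite -ge0_esumZl ?lee_fin// => [|k].
    by apply: eq_esum => k _; rewrite EFinM muleA.
  by rewrite mule_ge0 ?lee_fin.
rewrite (esum_cat_filter (p := p)) => [|l k|l k]; first last.
- rewrite negb_and => /orP[] /poisson_law_weight_on0 supp0.
    by rewrite /P supp0 mul0r mul0e.
  by rewrite /Q supp0 mulr0 mul0e.
- by rewrite mule_ge0// lee_fin mulr_ge0.
rewrite /wsum (esum_Node (x := s)); last first.
  by move=> t /broadcast_pmf_root ->; rewrite mul0e.
under eq_esum do rewrite broadcast_pmf_Node.
rewrite -offspring_intensity_own -offspring_intensity_opposite.
rewrite (esum_supp (A := [set cs | cs =
    [seq c <- cs | p c] ++ [seq c <- cs | ~~ p c]])) => [|cs /eqP/negbTE ->].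
  by apply: eq_esum => cs /= csE; rewrite -csE eqxx.
by rewrite mul0e.
Qed.

Lemma has_mass_offspring d s : (forall x, has_mass (broadcast_pmf a b d x) 1) ->
  has_mass (offspring_intensity d s) (a / 2 + b / 2).
Proof.
move=> pmf1; rewrite -[(a / 2)%R]mulr1 -[(b / 2)%R]mulr1.
by apply: has_massD; apply: has_massZ => //; exact: ltW.
Qed.

Lemma has_mass_broadcast d s : has_mass (broadcast_pmf a b d s) 1.
Proof.
elim: d s => [|d IHd] s; split=> [t|]; try exact: broadcast_pmf_ge0.
  rewrite (esum_supp1 (t := Node s [::]))/= ?eqxx ?lee_fin//.
  by move=> t /negbTE ->.
have /has_mass_poisson[_] := has_mass_offspring s IHd.
by rewrite -!wsum1 wsum_broadcast.
Qed.

Section BroadcastThinning.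
Variables (d : nat) (s : bool) (Y : choiceType) (p : pred (tree bool)).
Variables (h : tree bool -> Y) (e : Y -> Y -> Prop) (w : Y -> R) (m : R).
Hypothesis wm : has_mass w m.
Hypothesis wsum_kept : forall f : Y -> \bar R, (forall y, 0 <= f y) ->
  {homo f : y y' / e y y' >-> y = y'} ->
  wsum (weight_on p (offspring_intensity d s)) (f \o h) = wsum w f.

Let r := (a / 2 + b / 2 - m)%R.

Lemma has_mass_deleted :
  has_mass (weight_on (predC p) (offspring_intensity d s)) r.
Proof.
apply: has_mass_weight_onC; first exact/has_mass_offspring/has_mass_broadcast.
split; first exact/weight_on_ge0/offspring_intensity_ge0.
by rewrite -wsum1 -wm.2 -wsum1 -wsum_kept.
Qed.

Lemma wsum_broadcast_thin (F : tree bool -> \bar R)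
    (G : bool -> seq Y -> \bar R) :
  (forall t, 0 <= F t) -> (forall c l, 0 <= G c l) ->
  (forall c, list_invariant e (G c)) ->
  (forall l, F (Node s l) = G (all p l) [seq h c | c <- l & p c]) ->
  wsum (broadcast_pmf a b d.+1 s) F =
  wsum (poisson_law m w) (fun l =>
    (expR (- r))%:E * G true l + (1 - expR (- r))%:E * G false l).
Proof.
move=> F0 G0 G_inv FG; rewrite wsum_broadcast// => [|l l' ll']; last first.
  have := (G_inv (all p l)).1 _ _ (perm_map h (perm_filter p ll')).
  by rewrite !FG -(perm_all _ ll').
have -> : (a / 2 + b / 2 = m + r)%R by rewrite subrKC.
have offspring0 := offspring_intensity_ge0 d s.
rewrite -(wsum_poisson_thin _ offspring0 wm.1 wsum_kept has_mass_deleted)//.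
exact: eq_wsum.
Qed.

End BroadcastThinning.
End Broadcast.

(** * The cutting adversary *)

Section TreeIso.
Variable L : eqType.
Implicit Types (c : tree L) (cs : seq (tree L)).

Fixpoint tree_iso_refl c : tree_iso c c.
Proof.
case: c => x cs; constructor; elim: cs => [|c cs IHcs]; first by constructor.
exact: (@ForestIsoCons _ c c cs [::] cs).
Qed.

Lemma forest_iso_perm cs cs' : perm_eq cs cs' -> forest_iso cs cs'.
Proof.
elim: cs cs' => [|c cs IHcs] cs' eq_cs.
  by move: eq_cs; rewrite perm_sym => /perm_nilP ->; constructor.
have /splitPr cs'c : c \in cs' by rewrite -(perm_mem eq_cs) mem_head.
case: cs'c eq_cs => l r eq_cs; constructor; first exact: tree_iso_refl.
apply: IHcs; rewrite -(perm_cons c) (permPl eq_cs).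
by rewrite perm_catC/= perm_cons perm_catC.
Qed.

Lemma list_invariant_Node (Z : Type) (F : tree L -> Z) x :
  {homo F : t t' / tree_iso t t' >-> t = t'} ->
  list_invariant (@tree_iso L) (fun cs => F (Node x cs)).
Proof.
move=> F_iso; split=> [cs cs' eq_cs|c c' cs cc']; apply: F_iso; constructor.
  exact: forest_iso_perm.
exact: (@ForestIsoCons _ c c' cs [::] cs cc' (forest_iso_perm (perm_refl cs))).
Qed.

End TreeIso.

Definition childless (L : Type) (t : tree L) : bool := nilp (children t).

Definition dead_opposite (s : bool) (t : tree bool) : bool :=
  (root_label t == ~~ s) && childless t.

Definition singleton_of (T : Type) (p : pred T) (l : seq T) : bool :=
  (size l == 1%N) && all p l.

(* The presence of a [dead_opposite] child of [v], all of which are deleted, is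
   a random bit hidden from the estimator: it makes the deletion of the path
   from the parent through [v] to its grandchild rare enough not to reverse
   their correlation. *)
Definition cut_edge (s : bool) (v : tree bool) : bool :=
  let x := root_label v in
  [&& x == ~~ s, ~~ all (predC (dead_opposite x)) (children v) &
      singleton_of (fun w => root_label w == ~~ x)
        [seq w <- children v | ~~ dead_opposite x w]].

Fixpoint adversary (d : nat) (t : tree bool) : tree bool :=
  if d is (e.+1 as d').+2 then
    let: Node s cs := t in
    let prune v := let: Node x ws := v in
      Node x [seq adversary d' w | w <- ws & ~~ dead_opposite x w] in
    Node s [seq prune v | v <- cs & ~~ cut_edge s v]
  else t.

Fixpoint cut_tree_refl (t : tree bool) : cut_tree t t.
Proof.
by case: t => x cs; constructor; elim: cs => [|c cs IHcs]; constructor.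
Qed.

Lemma cut_children_map_filter s (p : pred (tree bool))
    (f : tree bool -> tree bool) cs :
  (forall c, cut_tree c (f c)) -> (forall c, ~~ p c -> root_label c = ~~ s) ->
  cut_children s cs [seq f c | c <- cs & p c].
Proof.
move=> f_cut p_opp; elim: cs => [|c cs IHcs] /=; first by constructor.
by case: ifPn => [_|/p_opp c_opp]; constructor.
Qed.

Lemma adversary_cutting : cutting_adversary adversary.
Proof.
move=> d; have [n] := ubnP d; elim: n d => // n IHn [|[|[|d]]] dn t;
  try exact: cut_tree_refl.
case: t => s cs; constructor; apply: cut_children_map_filter => [[x ws]|v].
  constructor; apply: cut_children_map_filter => [w|w].
    by apply: (IHn d.+1); rewrite (leq_trans _ (ltnSE dn)).
  by rewrite negbK => /andP[/eqP].
by rewrite negbK => /and3P[/eqP].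
Qed.

Definition observation d (t : tree bool) : tree (option bool) :=
  observe d (adversary d t).

Definition observed_child d (v : tree bool) : tree (option bool) :=
  Node None [seq observation d w
    | w <- children v & ~~ dead_opposite (root_label v) w].

Lemma observation_Node d s cs :
  observation d.+3 (Node s cs) =
  Node None [seq observed_child d.+1 v | v <- cs & ~~ cut_edge s v].
Proof.
rewrite /observation [adversary _ _]/= [observe _ _]/= -map_comp.
by congr (Node _ _); apply: eq_map => -[x ws]; rewrite /= -map_comp.
Qed.

Lemma observation_nil d s : observation d.+1 (Node s [::]) = Node None [::].
Proof. by case: d => [|[|d]]. Qed.

(** * The law of the observation *)

Section DampedPoisson.
Context {R : realType}.
Variables (T : choiceType) (v w : T -> R) (m : R).
Local Open Scope ereal_scope.

Definition marked (y : bool * T) : R := if y.1 then v y.2 else w y.2.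

(* The superposition of two Poisson processes of intensities [v] and [w], on the
   event that a process reduced to one point of [w] survives an independent
   trial of success probability [surv]. *)
Definition damped_poisson (surv : R) (l : seq T) : R :=
  if l is [:: x] then (expR (- m) * (v x + surv * w x))%R
  else poisson_law m (fun x => v x + w x)%R l.

Hypothesis v0 : forall x, (0 <= v x)%R.
Hypothesis w0 : forall x, (0 <= w x)%R.

Lemma marked_ge0 y : (0 <= marked y)%R.
Proof. by rewrite /marked; case: ifP. Qed.

Lemma damped_poisson_ge0 surv l :
  (0 <= surv)%R -> (0 <= damped_poisson surv l)%R.
Proof.
move=> surv0; have vw0 x : (0 <= v x + w x)%R by exact: addr_ge0.
case: l => [|x [|y l]] /=; try exact: poisson_law_ge0.
by rewrite mulr_ge0 ?expR_ge0// addr_ge0// mulr_ge0.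
Qed.

Lemma wsum_marked (F : bool * T -> \bar R) : (forall y, 0 <= F y) ->
  wsum marked F =
  wsum v (fun x => F (true, x)) + wsum w (fun x => F (false, x)).
Proof.
move=> F0; rewrite /wsum (esumID [set y : bool * T | y.1]); last first.
  by move=> y _; rewrite mule_ge0// lee_fin marked_ge0.
rewrite !setTI; congr (_ + _).
  apply: (reindex_esum [set: T] _ (pair true)).
  by split=> [x|x x' _ _ []|[[] x] //= _] //; exists x.
apply: (reindex_esum [set: T] _ (pair false)).
by split=> [x|x x' _ _ []|[[] x] //= _] //; exists x.
Qed.

Lemma wsum_poisson_marked (F : seq T -> \bar R) : (forall l, 0 <= F l) ->
  (forall l l', perm_eq l l' -> F l = F l') ->
  wsum (poisson_law m marked) (F \o map snd) =
  wsum (poisson_law m (fun x => v x + w x)%R) F.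
Proof.
move=> F0 F_perm; apply: (wsum_poisson_map (e := eq)) => //.
- exact: marked_ge0.
- by move=> x; exact: addr_ge0.
- by move=> f f0 _; rewrite wsum_marked ?wsumDw//= => y; exact: f0.
- by split=> // y _ l <-.
Qed.

Lemma wsum_poisson_marked_seq1 surv (F : T -> \bar R) : (0 <= surv)%R ->
  (forall x, 0 <= F x) ->
  wsum (fun y => poisson_law m marked [:: y])
    (fun y => (if y.1 then 1%R else surv)%:E * F y.2) =
  wsum (fun x => damped_poisson surv [:: x]) F.
Proof.
move=> surv0 F0; have expRNm_ge0 := expR_ge0 (- m).
have mark0 y : 0 <= (if y.1 then 1%R else surv)%:E * F y.2.
  by rewrite mule_ge0// lee_fin; case: ifP.
transitivity (wsum (fun y => expR (- m) * marked y)%R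
    (fun y => (if y.1 then 1%R else surv)%:E * F y.2)).
  by apply: eq_esum => y _; rewrite poisson_law_seq1.
rewrite wsumZw// ?wsum_marked//=; last exact: marked_ge0.
under eq_wsum do rewrite mul1e.
have damped0 x : (0 <= surv * w x)%R by exact: mulr_ge0.
by rewrite [RHS]wsumZw// ?wsumDw// ?wsumZw ?wsumZ// => x; exact: addr_ge0.
Qed.

Lemma wsum_damped_poisson surv (F : seq T -> \bar R) : (0 <= surv)%R ->
  (forall l, 0 <= F l) -> (forall l l', perm_eq l l' -> F l = F l') ->
  wsum (poisson_law m marked) (fun l =>
    (if singleton_of (fun y => ~~ y.1) l then surv else 1%R)%:E *
    F (map snd l)) =
  wsum (damped_poisson surv) F.
Proof.
move=> surv0 F0 F_perm.
have marked_law0 l : (0 <= poisson_law m marked l)%R.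
  exact/poisson_law_ge0/marked_ge0.
have damped0 l : (0 <= damped_poisson surv l)%R by exact: damped_poisson_ge0.
rewrite /wsum [LHS]esum_singletons => [|l]; last first.
  by rewrite !mule_ge0 ?lee_fin//; case: ifP.
rewrite [RHS]esum_singletons => [|l]; last by rewrite mule_ge0 ?lee_fin.
congr (_ + _); last first.
  rewrite -/(wsum (fun x => damped_poisson surv [:: x]) (fun x => F [:: x])).
  rewrite -wsum_poisson_marked_seq1//; apply: eq_esum => y _.
  by rewrite /singleton_of/= andbT if_neg.
transitivity (wsum (poisson_law m marked)
    ((fun l => if size l == 1%N then 0 else F l) \o map snd)).
  apply: eq_esum => l _; rewrite /= size_map /singleton_of.
  by case: (size l == 1%N); rewrite /= ?mule0 ?mul1e.
rewrite wsum_poisson_marked => [|l|l l' ll']; last 2 first.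
- by case: ifP.
- by rewrite (perm_size ll') (F_perm _ _ ll').
by apply: eq_esum => -[|x [|y l]] _ //=; rewrite ?mule0.
Qed.

End DampedPoisson.

Section DampedPoissonMass.
Context {R : realType}.
Variables (T : choiceType) (v w : T -> R) (p q : R).
Hypotheses (vp : has_mass v p) (wq : has_mass w q).

Lemma has_mass_marked : has_mass (marked v w) (p + q).
Proof.
have [v0 vE] := vp; have [w0 wE] := wq; split; first exact: marked_ge0.
by rewrite -wsum1 wsum_marked// !wsum1 vE wE.
Qed.

Lemma has_mass_damped_poisson m surv : 0 <= surv -> m = p + q ->
  has_mass (damped_poisson v w m surv) (1 - (1 - surv) * (expR (- m) * q)).
Proof.
move=> surv0 mE; have [v0 _] := vp; have [w0 _] := wq.
split=> [l|]; first exact: damped_poisson_ge0.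
have superposed : has_mass (fun x => v x + w x) m.
  by rewrite mE; exact: has_massD.
have lone_mass t : 0 <= t -> has_mass (fun x => expR (- m) * (v x + t * w x))
    (expR (- m) * (p + t * q)).
  move=> t0; apply: has_massZ (expR_ge0 _).
  by apply: has_massD => //; exact: has_massZ.
have nonsingleton_mass : (\esum_(l in [set: seq T]) (if size l == 1%N then 0
    else (damped_poisson v w m surv l)%:E) = (1 - expR (- m) * m)%:E)%E.
  apply: adde_EFin_eq; rewrite -(has_mass_poisson superposed).2 addeC.
  rewrite [RHS]esum_singletons => [|l]; last first.
    by rewrite lee_fin poisson_law_ge0// => x; exact: superposed.1.
  congr (_ + _)%E; first by apply: eq_esum => -[|x [|y l]].
  have := (lone_mass _ ler01).2; rewrite mul1r -mE => <-.
  by apply: eq_esum => x _; rewrite poisson_law_seq1 mul1r.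
rewrite esum_singletons => [|l]; last by rewrite lee_fin damped_poisson_ge0.
rewrite nonsingleton_mass (lone_mass _ surv0).2 -EFinD; congr EFin.
by rewrite {2}mE; ring.
Qed.

End DampedPoissonMass.

Section AtNode.
Context {R : realType}.
Variable p : seq (tree (option bool)) -> R.

Definition at_node (o : tree (option bool)) : R :=
  if o is Node None l then p l else 0.

Lemma at_node_ge0 : (forall l, 0 <= p l) -> forall o, 0 <= at_node o.
Proof. by move=> p0 [[]]. Qed.

Lemma wsum_at_node (F : tree (option bool) -> \bar R) :
  wsum at_node F = wsum p (F \o Node None).
Proof.
rewrite /wsum (esum_Node (x := None))// => -[[y|] l] //= _.
by rewrite mul0e.
Qed.

Lemma has_mass_at_node m : has_mass p m -> has_mass at_node m.
Proof.
move=> [p0 pm]; split; first exact: at_node_ge0.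
by rewrite -pm -!wsum1 wsum_at_node.
Qed.

End AtNode.

Section LiveLaw.
Context {R : realType}.
Variables a b : R.
Hypotheses (a0 : 0 < a) (b0 : 0 < b).
Local Notation T := (tree (option bool)).
Local Notation empty := (Node None [::] : T).
Implicit Type L : bool -> T -> R.
Local Open Scope ereal_scope.

Let a20 : (0 <= a / 2)%R. Proof. by rewrite divr_ge0// ltW. Qed.
Let b20 : (0 <= b / 2)%R. Proof. by rewrite divr_ge0// ltW. Qed.

Definition childless_prob : R := expR (- (a / 2 + b / 2)).

(* [L s] is the law of the observation on the event that the root, of spin [s],
   has a child in the precursor tree, up to isomorphism of observations. *)
Definition live_law d L : Prop :=
  (forall s o, (0 <= L s o)%R) /\
  forall s (F : bool -> T -> \bar R), (forall c o, 0 <= F c o) ->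
    (forall c, {homo F c : o o' / tree_iso o o' >-> o = o'}) ->
    wsum (broadcast_pmf a b d s) (fun t => F (childless t) (observation d t)) =
    wsum (L s) (F false) + childless_prob%:E * F true empty.

Definition dead_rate : R := (b / 2 * childless_prob)%R.
Definition no_dead_prob : R := expR (- dead_rate).
Definition grandchild_mass : R := (a / 2 + b / 2 - dead_rate)%R.

Definition own_intensity L x (o : T) : R :=
  (a / 2 * (L x o + childless_prob * (o == empty)%:R))%R.
Definition opposite_intensity L x (o : T) : R := (b / 2 * L (~~ x) o)%R.
Definition grandchild_intensity L x (o : T) : R :=
  (own_intensity L x o + opposite_intensity L x o)%R.

Definition kept_law (surv : R) L x : seq T -> R :=
  damped_poisson (own_intensity L x) (opposite_intensity L x)
    grandchild_mass surv.

(* A child with the spin of its parent is always kept; one of the opposite spin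
   and with a lone observed child of the spin of its parent is kept if none of
   its children is [dead_opposite]. *)
Definition child_forest_intensity L s (l : seq T) : R :=
  (a / 2 * kept_law 1 L s l + b / 2 * kept_law no_dead_prob L (~~ s) l)%R.
Definition child_intensity L s : T -> R := at_node (child_forest_intensity L s).

Definition child_mass : R :=
  (a / 2 + b / 2 * (1 - (1 - no_dead_prob) *
    (expR (- grandchild_mass) * (b / 2 * (1 - childless_prob)))))%R.

Definition next_law L s : T -> R := at_node (fun l =>
  poisson_law child_mass (child_intensity L s) l -
  (if nilp l then childless_prob else 0))%R.

Lemma childless_prob_ge0 : (0 <= childless_prob)%R.
Proof. exact: expR_ge0. Qed.

Lemma no_dead_prob_in01 : (0 <= no_dead_prob <= 1)%R.
Proof.
by rewrite expR_ge0 expR_le1 oppr_le0 mulr_ge0 ?childless_prob_ge0.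
Qed.

Lemma grandchild_massE :
  grandchild_mass = (a / 2 + b / 2 * (1 - childless_prob))%R.
Proof. by rewrite /grandchild_mass /dead_rate; ring. Qed.

Section Step.
Variables (d : nat) (L : bool -> T -> R).
Hypothesis Llaw : live_law d.+1 L.

Let L0 s o : (0 <= L s o)%R. Proof. exact: Llaw.1. Qed.

Lemma has_mass_live_law s : has_mass (L s) (1 - childless_prob).
Proof.
split=> //; apply: adde_EFin_eq; rewrite addeC.
have [_ <-] := has_mass_broadcast a0 b0 d.+1 s.
by rewrite -!wsum1 (Llaw.2 s (fun _ _ => 1))// mule1.
Qed.

Lemma own_intensity_ge0 x o : (0 <= own_intensity L x o)%R.
Proof. by rewrite mulr_ge0// addr_ge0// mulr_ge0 ?childless_prob_ge0. Qed.

Lemma opposite_intensity_ge0 x o : (0 <= opposite_intensity L x o)%R.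
Proof. exact: mulr_ge0. Qed.

Lemma wsum_own_intensity x (F : T -> \bar R) : (forall o, 0 <= F o) ->
  wsum (own_intensity L x) F =
  (a / 2)%:E * (wsum (L x) F + childless_prob%:E * F empty).
Proof.
move=> F0; have childless0 := childless_prob_ge0.
have atom0 o : (0 <= childless_prob * (o == empty)%:R)%R by exact: mulr_ge0.
rewrite wsumZw// => [|o]; last exact: addr_ge0.
rewrite wsumDw// [X in _ + X](esum_supp1 (t := empty)).
- by rewrite eqxx mulr1.
- by rewrite mule_ge0// lee_fin.
- by move=> o /negbTE ->; rewrite mulr0 mul0e.
Qed.

Lemma has_mass_own_intensity x : has_mass (own_intensity L x) (a / 2).
Proof.
split; first exact: own_intensity_ge0.
rewrite -wsum1 wsum_own_intensity// wsum1 (has_mass_live_law x).2 mule1.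
by rewrite -EFinD subrK mule1.
Qed.

Lemma has_mass_opposite_intensity x :
  has_mass (opposite_intensity L x) (b / 2 * (1 - childless_prob)).
Proof. by apply: has_massZ => //; exact: has_mass_live_law. Qed.

Lemma has_mass_grandchild_intensity x :
  has_mass (grandchild_intensity L x) grandchild_mass.
Proof.
rewrite grandchild_massE; apply: has_massD (has_mass_own_intensity x).
exact: has_mass_opposite_intensity.
Qed.

Lemma has_mass_kept_law surv x : (0 <= surv)%R ->
  has_mass (kept_law surv L x) (1 - (1 - surv) *
    (expR (- grandchild_mass) * (b / 2 * (1 - childless_prob)))).
Proof.
move=> surv0; apply: has_mass_damped_poisson grandchild_massE => //.
  exact: has_mass_own_intensity.
exact: has_mass_opposite_intensity.
Qed.

Lemma has_mass_child_intensity s : has_mass (child_intensity L s) child_mass.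
Proof.
apply: has_mass_at_node.
have /andP[no_dead0 _] := no_dead_prob_in01.
have opposite_mass := has_massZ (has_mass_kept_law (~~ s) no_dead0) b20.
have := has_massZ (has_mass_kept_law s ler01) a20.
by rewrite subrr mul0r subr0 mulr1; exact: has_massD opposite_mass _ _.
Qed.

Definition mark x (w : tree bool) : bool * T :=
  (root_label w == x, observation d.+1 w).

Definition mark_iso (y y' : bool * T) : Prop :=
  y.1 = y'.1 /\ tree_iso y.2 y'.2.

Lemma wsum_mark x (f : bool * T -> \bar R) : (forall y, 0 <= f y) ->
  {homo f : y y' / mark_iso y y' >-> y = y'} ->
  wsum (weight_on (predC (dead_opposite x)) (offspring_intensity a b d.+1 x))
    (f \o mark x) =
  wsum (marked (own_intensity L x) (opposite_intensity L x)) f.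
Proof.
move=> f0 f_iso; rewrite wsum_weight_on wsum_offspring//; last first.
  by move=> w; case: ifP => // _; exact: f0.
have own0 := own_intensity_ge0 x; have opposite0 := opposite_intensity_ge0 x.
rewrite wsum_marked//.
rewrite wsum_own_intensity// -(Llaw.2 x (fun _ o => f (true, o)))//; last first.
  by move=> c o o' oo'; exact: f_iso.
congr (_ * _ + _).
  apply: eq_wsum_broadcast => w wx.
  by rewrite /mark/= /dead_opposite wx eqxx; case: (x).
rewrite [RHS]wsumZw//; congr (_ * _).
rewrite -[RHS]adde0 -[X in _ + X](mule0 childless_prob%:E).
rewrite -(Llaw.2 (~~ x) (fun c o => if c then 0 else f (false, o))); first last.
- by case=> // o o' oo'; exact: f_iso.
- by case.
apply: eq_wsum_broadcast => w wx; rewrite /mark/= /dead_opposite wx eqxx/=.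
by case: childless => //=; case: (x).
Qed.

Lemma cut_edge_mark s x ws :
  cut_edge s (Node x ws) =
  [&& x == ~~ s, ~~ all (predC (dead_opposite x)) ws &
      singleton_of (fun y => ~~ y.1)
        [seq mark x w | w <- ws & ~~ dead_opposite x w]].
Proof.
rewrite /cut_edge /singleton_of/= size_map all_map.
congr [&& _, _, _ & _]; apply: eq_all => w /=.
by case: (root_label w) (x) => -[].
Qed.

Lemma wsum_observed_child s x (f : T -> \bar R) : (forall o, 0 <= f o) ->
  {homo f : o o' / tree_iso o o' >-> o = o'} ->
  wsum (broadcast_pmf a b d.+2 x)
    (fun v => if ~~ cut_edge s v then f (observed_child d.+1 v) else 0) =
  wsum (kept_law (if x == s then 1%R else no_dead_prob) L x) (f \o Node None).
Proof.
move=> f0 f_iso; have f_inv := list_invariant_Node None f_iso.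
have /andP[no_dead0 _] := no_dead_prob_in01.
pose lone_opposite (l : seq (bool * T)) := singleton_of (fun y => ~~ y.1) l.
pose G none_dead l := if ~~ [&& x == ~~ s, ~~ none_dead & lone_opposite l]
  then f (Node None (map snd l)) else 0.
have G0 c l : 0 <= G c l by rewrite /G; case: ifP.
have G_inv c : list_invariant mark_iso (G c).
  rewrite /G /lone_opposite /singleton_of.
  split=> [l l' ll'|[y o] [y' o'] l [/= <- oo']]; last first.
    by case: ifP => // _; exact: f_inv.2.
  by rewrite (perm_size ll') (perm_all _ ll') (f_inv.1 _ _ (perm_map snd ll')).
have marked_mass : has_mass
    (marked (own_intensity L x) (opposite_intensity L x)) grandchild_mass.
  rewrite grandchild_massE; apply: has_mass_marked (has_mass_own_intensity x) _.
  exact: has_mass_opposite_intensity.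
rewrite (wsum_broadcast_thin a0 b0 marked_mass (wsum_mark x) (G := G))//;
    first last.
- by move=> ws; rewrite cut_edge_mark /G /lone_opposite -map_comp.
- by move=> t; case: ifP.
rewrite (_ : _ + _ - grandchild_mass = dead_rate)%R; last by rewrite subKr.
rewrite -wsum_damped_poisson; first last.
- exact: f_inv.1.
- by move=> l; exact: f0.
- by case: ifP.
- exact: opposite_intensity_ge0.
- exact: own_intensity_ge0.
apply: eq_wsum => l; rewrite /G andbF/= -/(lone_opposite l) -/no_dead_prob.
have -> : (x == ~~ s) = (x != s) by case: (x); case: (s).
have mixE := mule_onemD no_dead_prob_in01 (f0 (Node None (map snd l))).
by case: eqP; case: (lone_opposite l); rewrite /= ?mixE ?mule0 ?adde0 ?mul1e.
Qed.

Lemma wsum_child s (f : T -> \bar R) : (forall o, 0 <= f o) ->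
  {homo f : o o' / tree_iso o o' >-> o = o'} ->
  wsum (weight_on (predC (cut_edge s)) (offspring_intensity a b d.+2 s))
    (f \o observed_child d.+1) =
  wsum (child_intensity L s) f.
Proof.
move=> f0 f_iso; have /andP[no_dead0 _] := no_dead_prob_in01.
rewrite wsum_weight_on wsum_offspring//; last first.
  by move=> v; case: ifP => // _; exact: f0.
rewrite !wsum_observed_child// eqxx (_ : (~~ s == s) = false); last first.
  by case: (s).
have kept0 surv x l : (0 <= surv)%R -> (0 <= kept_law surv L x l)%R.
  by move=> /(has_mass_kept_law x)[].
have fN0 l : 0 <= (f \o Node None) l by exact: f0.
rewrite wsum_at_node wsumDw ?wsumZw// => l; do ?apply: mulr_ge0 => //;
  exact: kept0.
Qed.

Lemma child_mass_le : (child_mass <= a / 2 + b / 2)%R.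
Proof.
have child_law := has_mass_child_intensity true.
by have := mass_ge0 (has_mass_deleted a0 b0 child_law (@wsum_child true)); lra.
Qed.

Lemma next_law_ge0 s o : (0 <= next_law L s o)%R.
Proof.
have [child0 _] := has_mass_child_intensity s.
apply: at_node_ge0 => l; case: ifP => [/nilP ->|_].
  by rewrite poisson_law_nil subr_ge0 ler_expR lerN2 child_mass_le.
by rewrite subr0 poisson_law_ge0.
Qed.

Lemma wsum_observation s (F : bool -> T -> \bar R) : (forall c o, 0 <= F c o) ->
  (forall c, {homo F c : o o' / tree_iso o o' >-> o = o'}) ->
  let none_cut := expR (- (a / 2 + b / 2 - child_mass)) in
  wsum (broadcast_pmf a b d.+3 s)
    (fun t => F (childless t) (observation d.+3 t)) =
  wsum (poisson_law child_mass (child_intensity L s)) (fun l =>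
    none_cut%:E * F (nilp l) (Node None l) +
    (1 - none_cut)%:E * F false (Node None l)).
Proof.
move=> F0 F_iso; pose G c (l : seq T) := F (c && nilp l) (Node None l).
have F_inv c : list_invariant (@tree_iso _) (fun l => F c (Node None l)).
  exact/list_invariant_Node/F_iso.
have G_inv c : list_invariant (@tree_iso _) (G c).
  split=> [l l' ll'|o o' l oo']; last exact: (F_inv _).2.
  by rewrite /G /nilp (perm_size ll'); exact: (F_inv _).1.
have child_law := has_mass_child_intensity s.
rewrite (wsum_broadcast_thin a0 b0 child_law (@wsum_child s) (G := G))//.
  by move=> c l; exact: F0.
move=> l; rewrite observation_Node /G; congr (F _ _).
by case: l => //= v l; case: ifP => //= _; rewrite andbF.
Qed.

Lemma live_law_next : live_law d.+3 (next_law L).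
Proof.
split=> [|s F F0 F_iso]; first exact: next_law_ge0.
rewrite wsum_observation//; set none_cut := expR _.
have none_cut01 : (0 <= none_cut <= 1)%R.
  by rewrite expR_ge0 expR_le1 oppr_le0 subr_ge0 child_mass_le.
have none_cut_nil : (expR (- child_mass) * none_cut = childless_prob)%R.
  by rewrite -expRD /childless_prob; congr expR; ring.
have /andP[none_cut0 none_cut1] := none_cut01.
have [child0 _] := has_mass_child_intensity s.
have law0 l := poisson_law_ge0 child0 child_mass l.
rewrite wsum_at_node /wsum (esumD1 [::]) => [|l]; last first.
  by rewrite mule_ge0 ?adde_ge0 ?mule_ge0 ?lee_fin ?subr_ge0//; exact: F0.
rewrite [in RHS](esumD1 [::]) => [|l]; last first.
  apply: mule_ge0; last exact: F0.
  by rewrite lee_fin; exact: next_law_ge0 s (Node None l).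
rewrite addeAC; congr (_ + _).
  rewrite /= poisson_law_nil ge0_muleDr ?mule_ge0 ?lee_fin ?subr_ge0//.
  by rewrite !muleA -!EFinM mulrBr mulr1 none_cut_nil addeC.
apply: eq_esum => -[|o l] //= _; rewrite subr0 mule_onemD//; exact: F0.
Qed.

End Step.
End LiveLaw.

(** * Contraction of the Hellinger distance *)

Section HellingerReal.
Context {R : realType}.
Implicit Types x y c A B : R.

Definition hellinger2 x y : R := (Num.sqrt x - Num.sqrt y) ^+ 2.

Lemma hellinger2_ge0 x y : 0 <= hellinger2 x y. Proof. exact: sqr_ge0. Qed.

Lemma hellinger2xx x : hellinger2 x x = 0.
Proof. by rewrite /hellinger2 subrr expr0n. Qed.

Lemma hellinger2M c x y : 0 <= c ->
  hellinger2 (c * x) (c * y) = c * hellinger2 x y.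
Proof.
by move=> c0; rewrite /hellinger2 !sqrtrM// -mulrBr exprMn sqr_sqrtr.
Qed.

Lemma hellinger2_affinity x y : 0 <= x -> 0 <= y ->
  hellinger2 x y + 2 * Num.sqrt (x * y) = x + y.
Proof.
move=> x0 y0; rewrite /hellinger2 sqrtrM//.
rewrite -[in RHS](sqr_sqrtr x0) -[in RHS](sqr_sqrtr y0); ring.
Qed.

Lemma sqr_sqrtD x y : 0 <= x -> 0 <= y ->
  (Num.sqrt x + Num.sqrt y) ^+ 2 = x + y + 2 * Num.sqrt (x * y).
Proof. by move=> x0 y0; rewrite sqrrD !sqr_sqrtr// sqrtrM//; ring. Qed.

Lemma hellinger2_sqr_sqrtD x y : 0 <= x -> 0 <= y ->
  hellinger2 x y * (Num.sqrt x + Num.sqrt y) ^+ 2 = (x - y) ^+ 2.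
Proof. by move=> x0 y0; rewrite -exprMn -subr_sqr !sqr_sqrtr. Qed.

Lemma hellinger2C x y : hellinger2 x y = hellinger2 y x.
Proof. by rewrite /hellinger2 -sqrrN opprB. Qed.

(* AM-GM: [x - y = n s <= n^2 / t + t s^2 / 4] with [n = sqrt x - sqrt y] and
   [s = sqrt x + sqrt y], whose square is at most [2 (x + y)]. *)
Lemma ler_mean_hellinger2 x y t : 0 <= x -> 0 <= y -> 0 < t ->
  x <= (2^-1 + t / 4) * (x + y) + (2 * t)^-1 * hellinger2 x y.
Proof.
rewrite /hellinger2 => x0 y0 t0; rewrite -subr_ge0.
have := sqr_sqrtr y0; have := sqr_sqrtr x0.
move: (Num.sqrt x) (Num.sqrt y) => p q <- <-.
rewrite (_ : _ - _ = 2^-1 * (t^-1 * ((p - q) - t / 2 * (p + q)) ^+ 2 +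
  t / 4 * (p - q) ^+ 2)); last by field; rewrite gt_eqF.
by rewrite mulr_ge0// addr_ge0// mulr_ge0 ?sqr_ge0 ?invr_ge0 ?divr_ge0// ltW.
Qed.

Definition mix_factor A B : R := (A - B) ^+ 2 / (A + B).

Lemma mix_factor_ge0 A B : 0 <= A + B -> 0 <= mix_factor A B.
Proof. by move=> AB0; rewrite divr_ge0// sqr_ge0. Qed.

Lemma sqrt_mix_ge A B c x y : 0 <= A -> 0 <= B -> 0 <= c -> 0 <= x -> 0 <= y ->
  (A + B) * Num.sqrt (x * y) <=
  Num.sqrt ((A * x + B * y + c) * (B * x + A * y + c)).
Proof.
move=> A0 B0 c0 x0 y0; have AB0 : 0 <= A + B by exact: addr_ge0.
rewrite -[A + B]ger0_norm// -sqrtr_sqr -sqrtrM ?sqr_ge0// ler_sqrt; last first.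
  by rewrite mulr_ge0 ?addr_ge0 ?mulr_ge0.
rewrite -subr_ge0 (_ : _ - _ =
  A * B * (x - y) ^+ 2 + c * ((A + B) * (x + y) + c)); last by ring.
apply: addr_ge0; apply: mulr_ge0 => //; [exact: mulr_ge0|exact: sqr_ge0|].
by rewrite addr_ge0// mulr_ge0// addr_ge0.
Qed.

(* The affinity does not decrease, so the sum of the square roots does not
   either, up to the factor [A + B]; it divides the difference. *)
Lemma hellinger2_mix A B c x y : 0 <= A -> 0 <= B -> 0 < A + B -> 0 <= c ->
  0 <= x -> 0 <= y ->
  hellinger2 (A * x + B * y + c) (B * x + A * y + c) <=
  mix_factor A B * hellinger2 x y.
Proof.
move=> A0 B0 AB0 c0 x0 y0; have := sqrt_mix_ge A0 B0 c0 x0 y0.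
set X := A * x + B * y + c; set Y := B * x + A * y + c => sqrtXY_ge.
have X0 : 0 <= X by rewrite !addr_ge0// mulr_ge0.
have Y0 : 0 <= Y by rewrite !addr_ge0// mulr_ge0.
have factor0 : 0 <= mix_factor A B * hellinger2 x y.
  by rewrite mulr_ge0 ?hellinger2_ge0// mix_factor_ge0// ltW.
have sqr_sqrtD_ge : (A + B) * (Num.sqrt x + Num.sqrt y) ^+ 2 <=
    (Num.sqrt X + Num.sqrt Y) ^+ 2.
  rewrite !sqr_sqrtD// mulrDr lerD//; last by rewrite mulrCA ler_pM2l.
  by rewrite /X /Y; move: c0; lra.
have [XY0|XY_neq0] := eqVneq (X + Y) 0.
  have [-> ->] : X = 0 /\ Y = 0 by move: XY0 X0 Y0; lra.
  by rewrite hellinger2xx.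
have sqr_sqrtD_gt0 : 0 < (Num.sqrt X + Num.sqrt Y) ^+ 2.
  rewrite sqr_sqrtD// ltr_wpDr ?mulr_ge0 ?sqrtr_ge0//.
  by rewrite lt_def XY_neq0 addr_ge0.
rewrite -(ler_pM2r sqr_sqrtD_gt0) hellinger2_sqr_sqrtD//.
apply: le_trans (ler_wpM2l factor0 sqr_sqrtD_ge).
rewrite (_ : X - Y = (A - B) * (x - y)); last by rewrite /X /Y; ring.
rewrite exprMn -(hellinger2_sqr_sqrtD x0 y0) le_eqVlt; apply/orP/or_introl/eqP.
by rewrite /mix_factor; field; rewrite gt_eqF.
Qed.

End HellingerReal.

Section Hellinger.
Context {R : realType}.
Local Open Scope ereal_scope.

Definition hellinger (T : choiceType) (f g : T -> R) : \bar R :=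
  \esum_(x in [set: T]) (hellinger2 (f x) (g x))%:E.

Definition affinity (T : Type) (f g : T -> R) (x : T) : R :=
  Num.sqrt (f x * g x)%R.

Let hellinger2E_ge0 (x y : R) : 0 <= (hellinger2 x y)%:E.
Proof. by rewrite lee_fin hellinger2_ge0. Qed.

Lemma hellinger_ge0 (T : choiceType) (f g : T -> R) : 0 <= hellinger f g.
Proof. exact: esum_ge0. Qed.

Lemma affinity_ge0 (T : Type) (f g : T -> R) x : (0 <= affinity f g x)%R.
Proof. exact: sqrtr_ge0. Qed.

Lemma le_hellinger (T : choiceType) (c : R) (f g f' g' : T -> R) : (0 <= c)%R ->
  (forall x, hellinger2 (f x) (g x) <= c * hellinger2 (f' x) (g' x))%R ->
  hellinger f g <= c%:E * hellinger f' g'.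
Proof.
move=> c0 le_fg; rewrite /hellinger -ge0_esumZl ?lee_fin//.
by apply: le_esum => x _; rewrite -EFinM lee_fin.
Qed.

Lemma hellinger_at_node (p q : seq (tree (option bool)) -> R) :
  hellinger (at_node p) (at_node q) = hellinger p q.
Proof.
rewrite /hellinger (esum_Node (x := None))// => -[[y|] l] //= _.
by rewrite hellinger2xx.
Qed.

Section HellingerMass.
Variables (T : choiceType) (f g : T -> R) (p q : R).
Hypotheses (fp : has_mass f p) (gq : has_mass g q).

Lemma hellinger_affinity :
  (p + q)%:E =
  hellinger f g + 2%:E * \esum_(x in [set: T]) (affinity f g x)%:E.
Proof.
have [f0 fE] := fp; have [g0 gE] := gq.
have affinityE_ge0 x : 0 <= (affinity f g x)%:E by rewrite lee_fin affinity_ge0.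
rewrite -ge0_esumZl ?lee_fin// EFinD -fE -gE /hellinger -!esumD//.
- by apply: eq_esum => x _; rewrite -EFinM -!EFinD hellinger2_affinity.
- by move=> x _; rewrite mule_ge0.
- by move=> x _; rewrite lee_fin.
- by move=> x _; rewrite lee_fin.
Qed.

Lemma hellinger_le_mass : hellinger f g <= (p + q)%:E.
Proof.
rewrite hellinger_affinity leeDl// mule_ge0 ?lee_fin// esum_ge0// => x _.
by rewrite lee_fin affinity_ge0.
Qed.

Lemma hellinger_fin : exists h : R,
  hellinger f g = h%:E /\ has_mass (affinity f g) ((p + q - h) / 2).
Proof.
have := hellinger_le_mass; have := hellinger_affinity.
case: (hellinger f g) (hellinger_ge0 f g) => [h _| |]// + _.
move/esym/adde_EFin_eq => affinityE.
exists h; split=> //; split=> [x|]; first exact: affinity_ge0.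
by rewrite mulrC EFinM -affinityE muleA -EFinM mulVf ?pnatr_eq0// mul1e.
Qed.

End HellingerMass.

Lemma affinity_poisson (T : choiceType) (f g : T -> R) p q l :
  (forall x, (0 <= f x)%R) -> (forall x, (0 <= g x)%R) ->
  affinity (poisson_law p f) (poisson_law q g) l =
  poisson_law ((p + q) / 2) (affinity f g) l.
Proof.
move=> f0 g0; rewrite /affinity /poisson_law mulrACA sqrtrM; last first.
  by rewrite mulr_ge0 ?poisson_coef_ge0.
congr (_ * _)%R.
  rewrite /poisson_coef mulrACA -expRD -expr2.
  rewrite (_ : - p + - q = 2 * - ((p + q) / 2))%R; last by field.
  by rewrite expRM_natl -exprMn sqrtr_sqr ger0_norm//.
elim: l => [|x l IHl]; first by rewrite !big_nil mulr1 sqrtr1.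
by rewrite !big_cons -IHl mulrACA sqrtrM// mulr_ge0.
Qed.

(* With [h] the right-hand side, the left-hand side is [2 (1 - exp (- h / 2))],
   as the affinity of Poisson processes is the exponential of the affinity. *)
Lemma hellinger_poisson (T : choiceType) (f g : T -> R) p q :
  has_mass f p -> has_mass g q ->
  hellinger (poisson_law p f) (poisson_law q g) <= hellinger f g.
Proof.
move=> fp gq; have [h [-> affinity_mass]] := hellinger_fin fp gq.
have [h' [-> [_ poisson_affinityE]]] :=
  hellinger_fin (has_mass_poisson fp) (has_mass_poisson gq).
have := (has_massZ (has_mass_poisson affinity_mass) (expR_ge0 (- (h / 2)))).2.
rewrite mulr1 lee_fin (_ : \esum_(x in _) _ = ((1 + 1 - h') / 2)%:E) => [[]|].
  by have := expR_ge1Dx (- (h / 2)); lra.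
rewrite -poisson_affinityE; apply: eq_esum => l _.
rewrite affinity_poisson; [|exact: fp.1|exact: gq.1].
rewrite /poisson_law /poisson_coef !mulrA -expRD; congr (expR _ * _ * _)%:E.
by field.
Qed.

Lemma hellinger_poisson_nonsingleton (T : choiceType) (f g : T -> R) m :
  has_mass f m -> has_mass g m ->
  \esum_(l in [set: seq T]) (if size l == 1%N then 0
    else (hellinger2 (poisson_law m f l) (poisson_law m g l))%:E) <=
  (1 - expR (- m))%:E * hellinger f g.
Proof.
move=> fm gm; have := hellinger_poisson fm gm.
have [h [hE _]] := hellinger_fin fm gm.
rewrite {1}/hellinger [X in X <= _ -> _]esum_singletons//.
rewrite [X in _ + X](_ : _ = (expR (- m) * h)%:E) ?hE; last first.
  rewrite EFinM -hE /hellinger -ge0_esumZl ?lee_fin ?expR_ge0//.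
  by apply: eq_esum => x _; rewrite !poisson_law_seq1 hellinger2M ?expR_ge0.
by rewrite -leeBrDr// -EFinB -EFinM mulrBl mul1r.
Qed.

(* Summing [ler_mean_hellinger2] bounds the left-hand side by
   [m + t m / 2 + t / 2]. *)
Lemma le_cam (T : choiceType) (f g : T -> R) (m t : R) (B : pred T) :
  has_mass f m -> has_mass g m -> (m <= 1)%R -> (0 < t)%R ->
  hellinger f g <= (t ^+ 2)%:E ->
  wsum f (fun x => (B x)%:R%:E) + wsum g (fun x => (~~ B x)%:R%:E) <=
  (m + t)%:E.
Proof.
move=> fm gm m1 t0 hellinger_le; have [[f0 _] [g0 _]] := (fm, gm).
pose u : R := (2^-1 + t / 4)%R; pose v : R := ((2 * t)^-1)%R.
have u0 : (0 <= u)%R by rewrite addr_ge0 ?divr_ge0 ?invr_ge0 ?(ltW t0).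
have v0 : (0 <= v)%R by rewrite invr_ge0 mulr_ge0 ?(ltW t0).
have fg0 x : 0 <= (f x + g x)%:E by rewrite lee_fin addr_ge0.
apply: (@le_trans _ _ (\esum_(x in [set: T])
  (u%:E * (f x + g x)%:E + v%:E * (hellinger2 (f x) (g x))%:E))).
  rewrite /wsum -esumD => [|x _|x _]; [|by rewrite mule_ge0 ?lee_fin..].
  apply: le_esum => x _; rewrite -!EFinM -!EFinD lee_fin.
  case: (B x); rewrite /= mulr1 mulr0 ?addr0 ?add0r.
    exact: ler_mean_hellinger2.
  by rewrite [(f x + _)%R]addrC hellinger2C; exact: ler_mean_hellinger2.
rewrite esumD => [|x _|x _]; [|by rewrite mule_ge0// lee_fin..].
rewrite !ge0_esumZl ?lee_fin// (has_massD gm fm).2.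
apply: (@le_trans _ _ (u%:E * (m + m)%:E + v%:E * (t ^+ 2)%:E)).
  by rewrite leeD2l// lee_wpmul2l ?lee_fin.
rewrite -!EFinM -EFinD lee_fin (_ : v * t ^+ 2 = t / 2)%R; last first.
  by rewrite /v; field; rewrite gt_eqF.
by rewrite /u; have := ler_pM2l t0 m 1%R; rewrite m1; lra.
Qed.

End Hellinger.

Section Contraction.
Context {R : realType}.
Variables a b : R.
Hypotheses (a0 : 0 < a) (b0 : 0 < b).
Local Notation T := (tree (option bool)).
Local Notation empty := (Node None [::] : T).
Local Notation no_grandchild_prob := (expR (- grandchild_mass a b)).

Let a20 : 0 < a / 2. Proof. by rewrite divr_gt0. Qed.
Let b20 : 0 < b / 2. Proof. by rewrite divr_gt0. Qed.

Definition edge_factor : R := mix_factor (a / 2) (b / 2).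

(* Up to the factor [no_grandchild_prob], the intensities of the paths of two
   edges without branching, whose ends have the same or opposite spins. *)
Definition same_spin_path : R :=
  (a / 2) ^+ 2 + no_dead_prob a b * (b / 2) ^+ 2.
Definition opposite_spin_path : R := 2 * (a / 2) * (b / 2).

Definition path_factor : R := mix_factor same_spin_path opposite_spin_path.

Definition block_factor : R :=
  edge_factor ^+ 2 * (1 - no_grandchild_prob) +
  no_grandchild_prob * path_factor.

Lemma edge_factor_ge0 : 0 <= edge_factor.
Proof. by apply: mix_factor_ge0; rewrite addr_ge0// ltW. Qed.

Lemma same_spin_path_ge0 : 0 <= same_spin_path.
Proof. by rewrite addr_ge0 ?sqr_ge0// mulr_ge0 ?expR_ge0 ?sqr_ge0. Qed.

Lemma opposite_spin_path_gt0 : 0 < opposite_spin_path.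
Proof. by rewrite !mulr_gt0. Qed.

Lemma path_gt0 : 0 < same_spin_path + opposite_spin_path.
Proof. by rewrite ltr_wpDl ?same_spin_path_ge0 ?opposite_spin_path_gt0. Qed.

Lemma path_factor_ge0 : 0 <= path_factor.
Proof. exact/mix_factor_ge0/ltW/path_gt0. Qed.

Lemma no_grandchild_prob_le1 : no_grandchild_prob <= 1.
Proof.
have [/ltW a2 /ltW b2] := (a20, b20).
rewrite expR_le1 oppr_le0 grandchild_massE addr_ge0// mulr_ge0//.
by rewrite subr_ge0 expR_le1 oppr_le0 addr_ge0.
Qed.

Lemma block_factor_ge0 : 0 <= block_factor.
Proof.
rewrite addr_ge0// mulr_ge0 ?expR_ge0 ?path_factor_ge0 ?sqr_ge0//.
by rewrite subr_ge0 no_grandchild_prob_le1.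
Qed.

Local Open Scope ereal_scope.

Section Step.
Variables (d : nat) (L : bool -> T -> R).
Hypothesis Llaw : live_law a b d.+1 L.

Let L0 s o : (0 <= L s o)%R. Proof. exact: Llaw.1. Qed.

Local Notation grandchildren := (grandchild_intensity a b L).
Local Notation forest := (child_forest_intensity a b L).
Local Notation poisson_forest s :=
  (poisson_law (grandchild_mass a b) (grandchildren s)).

Lemma hellinger_grandchild :
  hellinger (grandchildren true) (grandchildren false) <=
  edge_factor%:E * hellinger (L true) (L false).
Proof.
apply: le_hellinger edge_factor_ge0 _ => o.
pose atom : R := (a / 2 * (childless_prob a b * (o == empty)%:R))%R.
have atom0 : (0 <= atom)%R by rewrite !mulr_ge0 ?expR_ge0// ltW.
have grandchildE s :
    grandchildren s o = (a / 2 * L s o + b / 2 * L (~~ s) o + atom)%R.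
  rewrite /grandchild_intensity /own_intensity /opposite_intensity /atom.
  by ring.
rewrite !grandchildE/= (addrC (a / 2 * L false o)%R).
by apply: hellinger2_mix => //; rewrite ?addr_gt0// ltW.
Qed.

Lemma child_forest_nonsingleton s l : size l != 1%N ->
  forest s l = (a / 2 * poisson_forest s l + b / 2 * poisson_forest (~~ s) l)%R.
Proof. by case: l => [|o [|o' l]]. Qed.

Lemma child_forest_singleton s o :
  forest s [:: o] = (no_grandchild_prob *
    (same_spin_path * L s o + opposite_spin_path * L (~~ s) o +
     a / 2 * (a / 2 + b / 2) * (childless_prob a b * (o == empty)%:R)))%R.
Proof.
rewrite /child_forest_intensity /kept_law/= /own_intensity /opposite_intensity.
by rewrite negbK /same_spin_path /opposite_spin_path; ring.
Qed.

Lemma hellinger2_child_nonsingleton l : size l != 1%N ->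
  (hellinger2 (forest true l) (forest false l) <=
   edge_factor * hellinger2 (poisson_forest true l) (poisson_forest false l))%R.
Proof.
move=> l1; rewrite !child_forest_nonsingleton//= [X in hellinger2 _ X]addrC.
have forest0 s : (0 <= poisson_forest s l)%R.
  by apply/poisson_law_ge0; case: (has_mass_grandchild_intensity a0 b0 Llaw s).
have := hellinger2_mix (ltW a20) (ltW b20) (addr_gt0 a20 b20) (lexx 0%R)
  (forest0 true) (forest0 false).
by rewrite !addr0.
Qed.

Lemma hellinger2_child_singleton o :
  (hellinger2 (forest true [:: o]) (forest false [:: o]) <=
   no_grandchild_prob * path_factor * hellinger2 (L true o) (L false o))%R.
Proof.
rewrite !child_forest_singleton hellinger2M ?expR_ge0// -[leRHS]mulrA.
rewrite ler_pM2l ?expR_gt0//= (addrC (_ * L false o)%R).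
apply: hellinger2_mix => //.
- exact: same_spin_path_ge0.
- exact/ltW/opposite_spin_path_gt0.
- exact: path_gt0.
- by rewrite !mulr_ge0 ?expR_ge0 ?addr_ge0// ltW.
Qed.

Lemma hellinger_child :
  hellinger (child_intensity a b L true) (child_intensity a b L false) <=
  block_factor%:E * hellinger (L true) (L false).
Proof.
have forest_mass := has_mass_grandchild_intensity a0 b0 Llaw.
have hellinger2E_ge0 (x y : R) : 0 <= (hellinger2 x y)%:E.
  by rewrite lee_fin hellinger2_ge0.
have edge0 := edge_factor_ge0.
have branching0 : (0 <= 1 - no_grandchild_prob)%R.
  by rewrite subr_ge0 no_grandchild_prob_le1.
have edges0 : (0 <= edge_factor ^+ 2 * (1 - no_grandchild_prob))%R.
  exact: mulr_ge0 (sqr_ge0 _) branching0.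
have path0 : (0 <= no_grandchild_prob * path_factor)%R.
  exact: mulr_ge0 (expR_ge0 _) path_factor_ge0.
rewrite hellinger_at_node /hellinger [leLHS]esum_singletons//.
rewrite /block_factor EFinD ge0_muleDl ?lee_fin//; apply: leeD; last first.
  rewrite -ge0_esumZl ?lee_fin//; apply: le_esum => o _.
  by rewrite -EFinM lee_fin hellinger2_child_singleton.
apply: (@le_trans _ _ (edge_factor%:E * \esum_(l in [set: seq T])
    if size l == 1%N then 0
    else (hellinger2 (poisson_forest true l) (poisson_forest false l))%:E)).
  rewrite -ge0_esumZl ?lee_fin// => [|l]; last by case: ifP.
  apply: le_esum => l _; case: ifPn => l1; first by rewrite mule0.
  by rewrite -EFinM lee_fin hellinger2_child_nonsingleton.
rewrite expr2 -mulrA [in leRHS]EFinM -[leRHS]muleA lee_wpmul2l ?lee_fin//.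
have le_nonsingleton := hellinger_poisson_nonsingleton.
apply: le_trans (le_nonsingleton _ _ _ _ _ (forest_mass _) (forest_mass _)) _.
rewrite mulrC [in leRHS]EFinM -[leRHS]muleA lee_wpmul2l ?lee_fin//.
exact: hellinger_grandchild.
Qed.

Lemma hellinger_next :
  hellinger (next_law a b L true) (next_law a b L false) <=
  block_factor%:E * hellinger (L true) (L false).
Proof.
have child_law := has_mass_child_intensity a0 b0 Llaw.
apply: le_trans hellinger_child.
apply: le_trans (hellinger_poisson (child_law true) (child_law false)).
rewrite hellinger_at_node -[leRHS]mul1e; apply: le_hellinger => // l.
rewrite mul1r; case: ifP => [/nilP ->|_]; last by rewrite !subr0.
by rewrite !poisson_law_nil hellinger2xx hellinger2_ge0.
Qed.

End Step.

Lemma wsum_broadcast_childless d s (F : tree bool -> \bar R) :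
  0 <= F (Node s [::]) ->
  wsum (weight_on (@childless bool) (broadcast_pmf a b d.+1 s)) F =
  (childless_prob a b)%:E * F (Node s [::]).
Proof.
move=> F0; rewrite /wsum (esum_supp1 (t := Node s [::])).
- rewrite {1}/weight_on [childless _]/= broadcast_pmf_Node//=.
  by rewrite !poisson_law_nil -expRD -opprD.
- by rewrite mule_ge0// lee_fin weight_on_ge0// => t; exact: broadcast_pmf_ge0.
- move=> [x cs] xs; rewrite /weight_on; case: ifPn => [/nilP csE|_].
    rewrite broadcast_pmf_root ?mul0e//.
    by apply: contraNN xs => /eqP/= ->; apply/eqP; congr Node.
  by rewrite mul0e.
Qed.

Lemma live_law_exists d : exists L, live_law a b d.+1 L.
Proof.
pose pmf s := broadcast_pmf a b d.+1 s.
pose live_pmf s := weight_on (predC (@childless bool)) (pmf s).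
have pmf0 s t : (0 <= pmf s t)%R by exact: broadcast_pmf_ge0.
have live_mass s : has_mass (live_pmf s) (1 - childless_prob a b).
  apply: has_mass_weight_onC; first exact: has_mass_broadcast.
  split=> [t|]; first exact: weight_on_ge0.
  by rewrite -wsum1 wsum_broadcast_childless// mule1.
exists (fun s => pushforward (observation d.+1) (live_pmf s)).
split=> [s o|s F F0 F_iso]; first exact: pushforward_ge0 (live_mass s).1 _.
rewrite (wsum_pushforward _ (live_mass s))//.
rewrite (wsumID (pmf0 s) (@childless bool))//.
rewrite addeC; congr (_ + _); last first.
  by rewrite wsum_broadcast_childless ?observation_nil.
by rewrite !wsum_weight_on; apply: eq_wsum => t /=; case: childless.
Qed.

Lemma live_law_contracting n : exists2 L, live_law a b n.*2.+1 L &
  hellinger (L true) (L false) <= (2 * block_factor ^+ n)%:E.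
Proof.
elim: n => [|n [L Llaw L_contracting]].
  have [L Llaw] := live_law_exists 0; exists L => //.
  have Lmass := has_mass_live_law a0 b0 Llaw.
  apply: le_trans (hellinger_le_mass (Lmass true) (Lmass false)) _.
  by rewrite mulr1 lee_fin; have := childless_prob_ge0 a b; lra.
exists (next_law a b L); first exact: live_law_next.
apply: le_trans (hellinger_next Llaw) _.
by rewrite exprS mulrCA EFinM lee_wpmul2l// lee_fin block_factor_ge0.
Qed.

End Contraction.

(** * Impossibility of recovery *)

Section Recovery.
Context {R : realType}.
Variables a b : R.
Hypotheses (a0 : 0 < a) (b0 : 0 < b).
Local Notation T := (tree (option bool)).
Local Open Scope ereal_scope.

Lemma recovery_bound d L est (t : R) : live_law a b d.+1 L ->
  root_estimator est -> (0 < t)%R ->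
  hellinger (L true) (L false) <= (t ^+ 2)%:E ->
  broadcast_prob a b d.+1
    [set u | est d.+1 (observation d.+1 u) = root_label u] <= ((1 + t) / 2)%:E.
Proof.
move=> Llaw est_iso t0 L_close; pose q := childless_prob a b.
have q0 : (0 <= q)%R by exact: childless_prob_ge0.
pose guess s (o : T) : \bar R := (est d.+1 o == s)%:R%:E.
have guess0 s o : 0 <= guess s o by rewrite lee_fin.
have wsum_guess s : wsum (broadcast_pmf a b d.+1 s) (fun u =>
    (u \in [set u | est d.+1 (observation d.+1 u) = root_label u])%:R%:E) =
    wsum (L s) (guess s) + q%:E * guess s (Node None [::]).
  rewrite -(Llaw.2 s (fun=> guess s))//; last first.
    by move=> _ o o' oo'; rewrite /guess (est_iso _ _ _ oo').
  apply: eq_wsum_broadcast => u us; congr (nat_of_bool _)%:R%:E.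
  by apply/idP/eqP; rewrite inE/= us.
have guess_one : guess true (Node None [::]) + guess false (Node None [::]) = 1.
  by rewrite /guess; case: (est _ _); rewrite ?adde0 ?add0e.
have Lmass s : has_mass (L s) (1 - q) := has_mass_live_law a0 b0 Llaw s.
have q_le1 : (1 - q <= 1)%R by rewrite gerBl.
have := le_cam (est d.+1) (Lmass true) (Lmass false) q_le1 t0 L_close.
rewrite (eq_wsum _ (G := guess true)); last first.
  by move=> o; rewrite /guess eqb_id.
rewrite (eq_wsum (L false) (G := guess false)); last first.
  by move=> o; rewrite /guess eqbF_neg.
move=> guess_le; rewrite broadcast_probE !wsum_guess addeACA -ge0_muleDr//.
rewrite guess_one mule1 mulrC EFinM lee_wpmul2l ?lee_fin ?invr_ge0//.
by apply: le_trans (leeD2r _ guess_le) _; rewrite -EFinD lee_fin; lra.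
Qed.

Lemma no_partial_recovery est : (block_factor a b < 1)%R ->
  root_estimator est -> ~ partial_recovery a b adversary est.
Proof.
move=> contracting est_iso [eta eta_gt [N _ recovery]].
pose t := (eta - 2^-1)%R; have t0 : (0 < t)%R by rewrite subr_gt0.
have : (fun n => block_factor a b ^+ n)%R @ \oo --> (0 : R)%R.
  by apply: cvg_expr; rewrite ger0_norm ?block_factor_ge0.
have t2 : (0 < t ^+ 2 / 2)%R by rewrite divr_gt0 ?exprn_gt0.
move=> /cvgrPdist_lt /(_ _ t2)[M _ power_lt].
have [L Llaw L_contracting] := live_law_contracting a0 b0 (maxn N M).
have L_close : hellinger (L true) (L false) <= (t ^+ 2)%:E.
  apply: le_trans L_contracting _; rewrite lee_fin -ler_pdivlMl// mulrC ltW//.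
  have := power_lt _ (leq_maxr N M).
  by rewrite /= sub0r normrN ger0_norm// exprn_ge0 ?block_factor_ge0.
have leN : (N <= (maxn N M).*2.+1)%N.
  by rewrite -addnn -addnS (leq_trans (leq_maxl N M)) ?leq_addr.
have := le_trans (recovery _ leN) (recovery_bound Llaw est_iso t0 L_close).
by rewrite lee_fin /t; move: eta_gt; lra.
Qed.

End Recovery.

(** * Beyond the Kesten-Stigum threshold *)

Section Threshold.
Context {R : realType}.

Lemma mix_factor_path_lt1 (A B q : R) : 0 < B -> q < 1 ->
  (A - B) ^+ 2 = A + B -> 1 < A + B -> (1 - q) * B ^+ 2 < A + B ->
  mix_factor (A ^+ 2 + q * B ^+ 2) (2 * A * B) < 1.
Proof.
move=> B0 q1 critical; pose k := A + B; pose c := (1 - q) * B ^+ 2.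
rewrite -/k -/c => k1 ck.
have c0 : 0 < c by rewrite mulr_gt0 ?exprn_gt0 ?subr_gt0.
have difE : A ^+ 2 + q * B ^+ 2 - 2 * A * B = k - c.
  by rewrite /k -critical /c; ring.
have sumE : A ^+ 2 + q * B ^+ 2 + 2 * A * B = k ^+ 2 - c.
  by rewrite /k /c; ring.
rewrite /mix_factor difE sumE.
have k2 : k < k ^+ 2 by rewrite expr2 ltr_pMr// (lt_trans ltr01).
rewrite ltr_pdivrMr ?subr_gt0 ?(lt_trans ck)// mul1r -subr_gt0.
rewrite (_ : _ - _ = c * (2 * k - 1 - c)); last by ring.
by rewrite mulr_gt0//; move: ck k1; lra.
Qed.

Lemma damping_lt (B k : R) : 0 < B -> 2 * B <= k ->
  (1 - expR (- (B * expR (- k)))) * B ^+ 2 < k.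
Proof.
move=> B0 Bk; have k0 : 0 < k by move: B0 Bk; lra.
have k2_lt : k ^+ 2 < 8 * expR k.
  have := expR_ge1Dxn 1 (ltW k0); have := sqr_ge0 k.
  by rewrite -[2`!]/2%N; lra.
have B3_le : B ^+ 3 <= (k / 2) ^+ 3.
  by rewrite lerXn2r ?nnegrE ?divr_ge0 ?(ltW B0) ?(ltW k0)//; move: Bk; lra.
apply: (@le_lt_trans _ _ (B * expR (- k) * B ^+ 2)).
  rewrite ler_wpM2r ?sqr_ge0//.
  by have := expR_ge1Dx (- (B * expR (- k))); lra.
rewrite mulrAC -exprS expRN ltr_pdivrMr ?expR_gt0// (le_lt_trans B3_le)//.
rewrite (_ : (k / 2) ^+ 3 = k * (k ^+ 2 / 8)); last by field.
by rewrite ltr_pM2l// ltr_pdivrMr// mulrC.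
Qed.

Lemma block_factor_lt1 (a b : R) : 0 < b -> b < a ->
  (a / 2 - b / 2) ^+ 2 = a / 2 + b / 2 -> 1 < a / 2 + b / 2 ->
  block_factor a b < 1.
Proof.
move=> b0 ba critical k1; have b20 : 0 < b / 2 by rewrite divr_gt0.
have path_lt1 : path_factor a b < 1.
  apply: mix_factor_path_lt1 => //; last by apply: damping_lt => //; lra.
  by rewrite expR_lt1 oppr_lt0 mulr_gt0 ?expR_gt0.
have edge1 : edge_factor a b = 1.
  rewrite /edge_factor /mix_factor critical divff//.
  by rewrite gt_eqF// (lt_trans ltr01).
rewrite /block_factor edge1 expr1n mul1r -ltrBrDl subKr.
by rewrite gtr_pMr ?expR_gt0.
Qed.

Section Continuity.
Variables (U : Type) (F : set_system U).
Context {FF : Filter F}.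
Implicit Types f g : U -> R.

Lemma cvg_mix_factor f g (A B : R) : A + B != 0 -> f @ F --> A -> g @ F --> B ->
  mix_factor (f x) (g x) @[x --> F] --> mix_factor A B.
Proof.
move=> AB0 fA gB; apply: cvgM; first by apply: cvgM; exact: cvgB.
by apply: cvgV => //; exact: cvgD.
Qed.

Lemma cvg_expRN f (x : R) : f @ F --> x ->
  expR (- f u) @[u --> F] --> expR (- x).
Proof.
move=> fx; apply: continuous_cvg; first exact: continuous_expR.
exact: cvgN.
Qed.

Lemma cvg_block_factor f g (a b : R) : 0 < a -> 0 < b ->
  f @ F --> a -> g @ F --> b ->
  block_factor (f x) (g x) @[x --> F] --> block_factor a b.
Proof.
move=> a0 b0 fa gb.
have cvg_half h (x : R) : h @ F --> x -> h u / 2 @[u --> F] --> x / 2.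
  by move=> hx; apply: cvgM hx (cvg_cst _).
have own := cvg_half _ _ fa; have opposite := cvg_half _ _ gb.
have dead : dead_rate (f x) (g x) @[x --> F] --> dead_rate a b.
  by apply: cvgM => //; apply: cvg_expRN; exact: cvgD.
have no_grandchild : expR (- grandchild_mass (f x) (g x)) @[x --> F] -->
    expR (- grandchild_mass a b).
  by apply: cvg_expRN; apply: cvgB => //; exact: cvgD.
have edge : edge_factor (f x) (g x) @[x --> F] --> edge_factor a b.
  by apply: cvg_mix_factor => //; rewrite gt_eqF// addr_gt0// divr_gt0.
apply: cvgD; apply: cvgM => //; first exact: cvgM.
  by apply: cvgB => //; exact: cvg_cst.
apply: cvg_mix_factor; first by rewrite gt_eqF// path_gt0.
  apply: cvgD; first exact: cvgM.
  by apply: cvgM; [exact: cvg_expRN|exact: cvgM].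
by apply: cvgM => //; apply: cvgM => //; exact: cvg_cst.
Qed.

End Continuity.

Lemma cvg_block_factor_eps (k eps : R) : 0 < k -> 0 < eps -> eps < 1 ->
  block_factor (2 * k * (1 - e)) (2 * k * e) @[e --> eps] -->
  block_factor (2 * k * (1 - eps)) (2 * k * eps).
Proof.
move=> k0 eps0 eps1; apply: cvg_block_factor.
- by rewrite !mulr_gt0// subr_gt0.
- by rewrite !mulr_gt0.
- by apply: cvgM; [exact: cvg_cst|apply: cvgB; [exact: cvg_cst|exact: cvg_id]].
- by apply: cvgM; [exact: cvg_cst|exact: cvg_id].
Qed.

Lemma block_factor_critical (k eps : R) : 1 < k -> 0 < eps -> eps < 2^-1 ->
  k * (1 - 2 * eps) ^+ 2 = 1 ->
  block_factor (2 * k * (1 - eps)) (2 * k * eps) < 1.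
Proof.
move=> k1 eps0 eps2 critical; have k0 : 0 < k := lt_trans ltr01 k1.
have half_a : 2 * k * (1 - eps) / 2 = k * (1 - eps) by field.
have half_b : 2 * k * eps / 2 = k * eps by field.
apply: block_factor_lt1; rewrite ?half_a ?half_b.
- by rewrite !mulr_gt0.
- by rewrite ltr_pM2l ?mulr_gt0//; move: eps2; lra.
- rewrite (_ : _ ^+ 2 = k * (k * (1 - 2 * eps) ^+ 2)); last by ring.
  by rewrite critical; ring.
- by rewrite -mulrDr subrK mulr1.
Qed.

Lemma critical_eps_exists (k : R) : 1 < k ->
  exists eps : R, [/\ 0 < eps, eps < 2^-1 & k * (1 - 2 * eps) ^+ 2 = 1].
Proof.
move=> k1; have k0 : 0 < k := lt_trans ltr01 k1.
exists ((1 - Num.sqrt k^-1) / 2); split.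
- by rewrite divr_gt0// subr_gt0 -[ltRHS]sqrtr1 ltr_sqrt// invf_lt1.
- by rewrite ltr_pdivrMr// mulVf// gtrBl sqrtr_gt0 invr_gt0.
- rewrite (_ : 1 - 2 * _ = Num.sqrt k^-1); last by field.
  by rewrite sqr_sqrtr ?invr_ge0 ?ltW// divff// gt_eqF.
Qed.

Lemma contracting_eps_exists (k : R) : 1 < k -> exists eps : R,
  [/\ 0 < eps, eps < 2^-1, 1 < k * (1 - 2 * eps) ^+ 2 &
      block_factor (2 * k * (1 - eps)) (2 * k * eps) < 1].
Proof.
move=> k1; have k0 : 0 < k := lt_trans ltr01 k1.
have [eps [eps0 eps2 critical]] := critical_eps_exists k1.
have eps1 : eps < 1 by move: eps2; lra.
have [e [e_gt0 e_lt contracting]] : exists e : R, [/\ 0 < e, e < eps &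
    block_factor (2 * k * (1 - e)) (2 * k * e) < 1].
  near eps^'- => e; exists e; split; near: e.
  - exact: nbhs_left_gt.
  - exact: nbhs_left_lt.
  - apply: cvgr_lt (block_factor_critical k1 eps0 eps2 critical).
    exact/cvg_at_left_filter/cvg_block_factor_eps.
exists e; split => //; first exact: lt_trans e_lt eps2.
by rewrite -[ltLHS]critical ltr_pM2l// ltr_sqr ?nnegrE; move: e_lt eps2; lra.
Unshelve. all: by end_near.
Qed.

End Threshold.

Theorem theorem3 (R : realType) (k : R) (hk : 1 < k) :
  exists eps : R,
    [/\ 0 < eps, eps < 2^-1, 1 < k * (1 - 2 * eps) ^+ 2 &
      exists2 adv : nat -> tree bool -> tree bool,
        cutting_adversary adv &
        forall est : nat -> tree (option bool) -> bool,
          root_estimator est ->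
          ~ partial_recovery (2 * k * (1 - eps)) (2 * k * eps) adv est].
Proof.
have [eps [eps_gt0 eps_lt above_threshold contracting]] :=
  contracting_eps_exists hk.
have k_gt0 : 0 < k := lt_trans ltr01 hk.
exists eps; split => //; exists adversary; first exact: adversary_cutting.
move=> est est_iso; apply: no_partial_recovery => //; last by rewrite !mulr_gt0.
by rewrite !mulr_gt0// subr_gt0; move: eps_lt; lra.
Qed.
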